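(* Let $k$ be a field of characteristic $0$ and let $q\in k^\times$ be not a root of unity. Let $k[x]\#k[y]$ be the quantum plane, i.e. the vector space $k[x]\otimes k[y]$ with the multiplication determined by $y^jx^i=q^{ij}x^iy^j$ for all $i,j\ge 0$. Then its Hochschild homology is $$HH_n(k[x]\#k[y])\cong\begin{cases} k[x]\oplus yk[y] & \text{if } n=0,\\ k[x]\oplus k[y] & \text{if } n=1,\\ 0 & \text{if } n\ge 2,\end{cases}$$ as $k$-vector spaces.
   Context: $HH_n(C)=H_n(C,C)=\mathrm{Tor}_n^{C\otimes C^{\mathrm{op}}}(C,C)$ denotes the Hochschild homology over $k$ of a unital associative $k$-algebra $C$ with coefficients in itself. *)

(* Defs.v *)
From HB Require Import structures.
From mathcomp Require Import all_boot all_algebra.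
From mathcomp Require Import boolp.
From mathcomp Require Import freeg.

Set Implicit Arguments.
Unset Strict Implicit.
Unset Printing Implicit Defensive.

Import GRing.Theory.
Local Open Scope ring_scope.
Local Open Scope quotient_scope.

Definition lmod_iso (k : nzRingType) (V W : lmodType k) : Prop :=
  exists f : {linear V -> W}, bijective f.

Section LmodQuotient.
Context (k : nzRingType) (V : lmodType k) (S : submodClosed V).

Definition submod_pred : {pred V} := S.

Fact submod_pred_zmod_closed : zmod_closed submod_pred.
Proof.
split=> [|x y xS yS]; first exact: (@rpred0 _ S).
by apply: (@rpredD _ S) => //; rewrite -scaleN1r; apply: (@rpredZ _ _ S).
Qed.

HB.instance Definition _ :=
  GRing.isZmodClosed.Build V submod_pred submod_pred_zmod_closed.

Definition lquot : Type := Quotient.quot submod_pred.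
HB.instance Definition _ := GRing.Zmodule.on lquot.

Definition lproj (v : V) : lquot := \pi_(Quotient.quot submod_pred) v.
Definition lrepr (x : lquot) : V := repr (x : Quotient.quot submod_pred).

Lemma lreprK x : lproj (lrepr x) = x.
Proof. exact: reprK. Qed.

Lemma lprojE u v : (lproj u == lproj v) = (u - v \in S).
Proof. exact: esym (Quotient.idealrBE (submod_pred : zmodClosed V) u v). Qed.

Fact lproj_is_zmod_morphism : zmod_morphism lproj.
Proof. exact: (raddfB (\pi_(Quotient.quot submod_pred))). Qed.
HB.instance Definition _ :=
  GRing.isZmodMorphism.Build V lquot lproj lproj_is_zmod_morphism.

Definition lquot_scale (c : k) (x : lquot) : lquot := lproj (c *: lrepr x).

Lemma lquot_scale_proj c v : lquot_scale c (lproj v) = lproj (c *: v).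
Proof.
apply/eqP; rewrite lprojE -scalerBr; apply: (@rpredZ _ _ S).
by rewrite -lprojE lreprK.
Qed.

Fact lquot_scaleA a b v :
  lquot_scale a (lquot_scale b v) = lquot_scale (a * b) v.
Proof. by rewrite -[v]lreprK !lquot_scale_proj scalerA. Qed.
Fact lquot_scale1 : left_id 1 lquot_scale.
Proof. by move=> v; rewrite -[v]lreprK !lquot_scale_proj scale1r. Qed.
Fact lquot_scaleDr : right_distributive lquot_scale +%R.
Proof.
move=> a u v; rewrite -[u]lreprK -[v]lreprK -raddfD !lquot_scale_proj.
by rewrite -raddfD scalerDr.
Qed.
Fact lquot_scaleDl v : {morph lquot_scale^~ v : a b / a + b}.
Proof.
by move=> a b /=; rewrite -[v]lreprK !lquot_scale_proj -raddfD scalerDl.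
Qed.

HB.instance Definition _ := GRing.Zmodule_isLmodule.Build k lquot
  lquot_scaleA lquot_scale1 lquot_scaleDr lquot_scaleDl.

Fact lproj_is_scalable : scalable lproj.
Proof. by move=> c v; rewrite -lquot_scale_proj. Qed.
HB.instance Definition _ :=
  GRing.isScalable.Build k V lquot *:%R lproj lproj_is_scalable.

Section Lift.
Context (W : lmodType k) (f : {linear V -> W}).
Hypothesis fS : forall v, v \in S -> f v = 0.

Definition lquot_lift (x : lquot) : W := f (lrepr x).

Lemma lquot_lift_proj v : lquot_lift (lproj v) = f v.
Proof.
apply/eqP; rewrite -subr_eq0 -raddfB; apply/eqP/fS.
by rewrite -lprojE lreprK.
Qed.

Lemma lquot_lift_is_linear : linear lquot_lift.
Proof.
move=> c x y; rewrite -[x]lreprK -[y]lreprK -linearP !lquot_lift_proj.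
exact: linearP.
Qed.
End Lift.
End LmodQuotient.

Section Span.
Context (k : nzRingType) (V : lmodType k) (G : V -> Prop).

Inductive spans : V -> Prop :=
| spans0 : spans 0
| spansZD c g v : G g -> spans v -> spans (c *: g + v).

Definition span_pred : {pred V} := fun v => `[< spans v >].

Fact span_pred_closed : GRing.subsemimod_closed span_pred.
Proof.
have cD u v : spans u -> spans v -> spans (u + v).
  move=> su sv; elim: su => [|c g w Gg _ IH]; first by rewrite add0r.
  by rewrite -addrA; constructor.
have cZ c v : spans v -> spans (c *: v).
  elim=> [|d g w Gg _ IH]; first by rewrite scaler0; constructor.
  by rewrite scalerDr scalerA; constructor.
split; first split.
- by apply/asboolP; constructor.
- by move=> u v /asboolP su /asboolP sv; apply/asboolP; apply: cD.
- by move=> c v /asboolP sv; apply/asboolP; apply: cZ.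
Qed.
HB.instance Definition _ :=
  GRing.isSubSemiModClosed.Build k V span_pred span_pred_closed.

Lemma span_gen g : G g -> g \in span_pred.
Proof.
move=> Gg; apply/asboolP; rewrite -[g]addr0 -[g]scale1r.
by apply: spansZD => //; apply: spans0.
Qed.
End Span.

(* A right E-module whose underlying additive group is a k-vector space on
   which E acts k-linearly. *)
Record rmodType (k : fieldType) (E : pzRingType) := RMod {
  rmod_sort :> lmodType k;
  ract : rmod_sort -> E -> rmod_sort;
  ract_linear : forall e, linear (ract^~ e);
  ractDr : forall m, {morph ract m : e e' / e + e'};
  ractA : forall m e e', ract m (e * e') = ract (ract m e) e';
  ract1 : forall m, ract m 1 = m }.

Section Tensor.
Context (k : fieldType) (E : pzRingType) (M : rmodType k E) (N : lmodType E).

Local Notation free := {freeg (M * N)%type / k}.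
Local Notation gen m n := (<< (m, n) >> : free).

(* The tensor product of M and N over E, as a k-vector space: the free vector
   space on M x N modulo k-linearity in M, additivity in N and E-balancedness
   (k acts through M). *)
Inductive tensor_rel : free -> Prop :=
| TensorL c m m' n :
    tensor_rel (gen (c *: m + m') n - (c *: gen m n + gen m' n))
| TensorR m n n' : tensor_rel (gen m (n + n') - (gen m n + gen m n'))
| TensorE m e n : tensor_rel (gen (ract m e) n - gen m (e *: n)).

Definition tensor : Type := lquot (span_pred tensor_rel).
HB.instance Definition _ := GRing.Lmodule.on tensor.

Definition tens (m : M) (n : N) : tensor := lproj _ (gen m n).

Definition balanced (W : lmodType k) (f : M -> N -> W) : Prop :=
  [/\ forall n, linear (f^~ n),
      forall m, {morph f m : n n' / n + n'} &
      forall m e n, f (ract m e) n = f m (e *: n)].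

Lemma tens_balanced : balanced tens.
Proof.
split=> [n c m m'|m n n'|m e n]; apply/eqP; rewrite /tens.
- by rewrite -linearP lprojE; apply/span_gen/TensorL.
- by rewrite -raddfD lprojE; apply/span_gen/TensorR.
- by rewrite lprojE; apply/span_gen/TensorE.
Qed.

Lemma tens_ind (P : tensor -> Prop) :
  P 0 -> (forall m n x, P x -> P (tens m n + x)) -> forall x, P x.
Proof.
move=> P0 PD x; rewrite -[x]lreprK.
elim/freeg_ind_dom0: (lrepr x) => [|c [m n] D _ _ IH]; first by rewrite raddf0.
have -> : << c *g (m, n) >> = c *: gen m n :> free.
  by apply/eqP/freeg_eqP => z; rewrite coeffZ !coeffU mul1r.
rewrite linearP.
have [tl _ _] := tens_balanced.
suff -> : c *: lproj (span_pred tensor_rel) (gen m n) = tens (c *: m) n.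
  exact: PD.
have t0 : tens 0 n = 0.
  by have /eqP := tl n (-1) 0 0; rewrite scaler0 addr0 scaleN1r addNr => /eqP.
by have := tl n c m 0; rewrite t0 !addr0.
Qed.

Section Lift.
Context (W : lmodType k) (f : M -> N -> W) (fb : balanced f).

Let free_lift (x : free) : W := fglift (fun p => f p.1 p.2) x.

Fact free_lift_is_linear : linear free_lift.
Proof.
have fB : {morph free_lift : x y / x - y} by exact: lift_is_additive.
have f0 : free_lift 0 = 0 by rewrite -(subrr 0) fB subrr.
have fN x : free_lift (- x) = - free_lift x by rewrite -sub0r fB f0 sub0r.
have fD x y : free_lift (x + y) = free_lift x + free_lift y.
  by rewrite -[y in LHS]opprK fB fN opprK.
move=> c x y; rewrite fD; congr (_ + _).
elim/freeg_ind_dom0: x => [|d p x _ _ IH]; first by rewrite scaler0 f0 scaler0.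
rewrite scalerDr !fD IH scalerDr; congr (_ + _).
have -> : c *: << d *g p >> = << (c * d) *g p >> :> free.
  by apply/eqP/freeg_eqP => z; rewrite coeffZ !coeffU mulrA.
by rewrite /free_lift !liftU scalerA.
Qed.
HB.instance Definition _ :=
  GRing.isLinear.Build k free W _ free_lift free_lift_is_linear.

Fact free_lift_rel x : x \in span_pred tensor_rel -> free_lift x = 0.
Proof.
have fU m n : free_lift (gen m n) = f m n by rewrite /free_lift liftU scale1r.
have [fl fr fe] := fb.
have lB u v : free_lift (u - v) = free_lift u - free_lift v by exact: raddfB.
have lD u v : free_lift (u + v) = free_lift u + free_lift v by exact: raddfD.
move/asboolP; elim=> [|c g v]; first exact: raddf0.
case=> [d m m' n|m n n'|m e n] _ IH;
  rewrite free_lift_is_linear {}IH addr0.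
- by rewrite lB free_lift_is_linear !fU /= fl subrr scaler0.
- by rewrite lB lD !fU /= fr subrr scaler0.
- by rewrite lB !fU fe subrr scaler0.
Qed.

Let tlift_fun : tensor -> W := lquot_lift free_lift.

Fact tlift_is_linear : linear tlift_fun.
Proof. exact: lquot_lift_is_linear free_lift_rel. Qed.

Definition tlift : {linear tensor -> W} :=
  HB.pack tlift_fun
    (GRing.isLinear.Build k tensor W _ tlift_fun tlift_is_linear).

Lemma tlift_tens m n : tlift (tens m n) = f m n.
Proof.
apply: etrans (lquot_lift_proj free_lift_rel _) _.
exact: etrans (liftU _ _ _) (scale1r _).
Qed.
End Lift.
End Tensor.
Arguments tlift : simpl never.

Section VectorSpaceAsRightModule.
Context (k : fieldType) (V : lmodType k).

Let act (v : V) (c : k) : V := c *: v.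

Fact vs_act_linear c : linear (act^~ c).
Proof. by move=> d u v; rewrite /act /= scalerDr !scalerA mulrC. Qed.
Fact vs_actDr v : {morph act v : c d / c + d}.
Proof. by move=> c d; rewrite /act scalerDl. Qed.
Fact vs_actA v c d : act v (c * d) = act (act v c) d.
Proof. by rewrite /act scalerA mulrC. Qed.
Fact vs_act1 v : act v 1 = v.
Proof. exact: scale1r. Qed.

Definition vs_rmod : rmodType k k :=
  RMod vs_act_linear vs_actDr vs_actA vs_act1.
End VectorSpaceAsRightModule.

Section TensorAlgebra.
Context (k : fieldType) (A B : algType k).

(* The algebra A (x) B over k, with (a (x) b)(a' (x) b') = aa' (x) bb'. *)
Definition talg : Type := tensor (vs_rmod A) B.
HB.instance Definition _ := GRing.Lmodule.on talg.

Definition ptens (a : A) (b : B) : talg := tens (M := vs_rmod A) a b.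

Lemma ptensDl a a' b : ptens (a + a') b = ptens a b + ptens a' b.
Proof.
have [fl _ _] := tens_balanced (vs_rmod A) B.
by have := fl b 1 a a'; rewrite !scale1r.
Qed.
Lemma ptensDr a b b' : ptens a (b + b') = ptens a b + ptens a b'.
Proof. by have [_ fr _] := tens_balanced (vs_rmod A) B; apply: fr. Qed.
Lemma ptens0l b : ptens 0 b = 0.
Proof. by apply: (addrI (ptens 0 b)); rewrite -ptensDl !addr0. Qed.
Lemma ptensZl c a b : ptens (c *: a) b = c *: ptens a b.
Proof.
have [fl _ _] := tens_balanced (vs_rmod A) B.
by have := fl b c a 0; rewrite -[tens 0 b]/(ptens 0 b) ptens0l !addr0.
Qed.
Lemma ptensZr c a b : ptens a (c *: b) = c *: ptens a b.
Proof.
have [_ _ fe] := tens_balanced (vs_rmod A) B.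
by rewrite -ptensZl; apply/esym/(fe a c b).
Qed.

Lemma ptens_ind (P : talg -> Prop) :
  P 0 -> (forall a b x, P x -> P (ptens a b + x)) -> forall x, P x.
Proof. exact: (@tens_ind k k (vs_rmod A) B P). Qed.

Fact talg_mul_balanced1 (a : A) (b : B) :
  balanced (M := vs_rmod A) (fun a' b' => ptens (a * a') (b * b')).
Proof.
split=> [b' c u v|a' u v|a' c b'] /=.
- by rewrite mulrDr -scalerAr ptensDl ptensZl.
- by rewrite mulrDr ptensDr.
- by rewrite -!scalerAr ptensZl ptensZr.
Qed.

Definition talg_mul1 (a : A) (b : B) (x : talg) : talg :=
  tlift (talg_mul_balanced1 a b) x.

Arguments talg_mul1 : simpl never.

Lemma talg_mul1E a b a' b' :
  talg_mul1 a b (ptens a' b') = ptens (a * a') (b * b').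
Proof. exact: tlift_tens. Qed.

Lemma talg_mul1D a b : {morph talg_mul1 a b : x y / x + y}.
Proof. by move=> x y; exact: raddfD. Qed.
Lemma talg_mul10 a b : talg_mul1 a b 0 = 0.
Proof. exact: raddf0. Qed.
Lemma talg_mul1Z a b c : {morph talg_mul1 a b : x / c *: x}.
Proof. by move=> x; exact: linearZ_LR. Qed.

Fact talg_mul_balanced (y : talg) :
  balanced (M := vs_rmod A) (fun a b => talg_mul1 a b y).
Proof.
split=> [b c u v|a u v|a c b] /=; elim/ptens_ind: y => [|a' b' y IH].
- by rewrite !talg_mul10 scaler0 addr0.
- rewrite !talg_mul1D !talg_mul1E IH scalerDr addrACA; congr (_ + _).
  by rewrite mulrDl -scalerAl ptensDl ptensZl.
- by rewrite !talg_mul10 addr0.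
- rewrite !talg_mul1D !talg_mul1E IH addrACA; congr (_ + _).
  by rewrite mulrDl ptensDr.
- by rewrite !talg_mul10.
- by rewrite !talg_mul1D !talg_mul1E IH -!scalerAl ptensZl ptensZr.
Qed.

Definition talg_mul (x y : talg) : talg := tlift (talg_mul_balanced y) x.
Definition talg_one : talg := ptens 1 1.

Lemma talg_mul_pl a b y : talg_mul (ptens a b) y = talg_mul1 a b y.
Proof. exact: tlift_tens. Qed.
Lemma talg_mulE a b a' b' :
  talg_mul (ptens a b) (ptens a' b') = ptens (a * a') (b * b').
Proof. by rewrite talg_mul_pl talg_mul1E. Qed.

Fact talg_mulDl : left_distributive talg_mul +%R.
Proof. by move=> x y z; exact: raddfD. Qed.
Fact talg_mul0l x : talg_mul 0 x = 0.
Proof. exact: raddf0. Qed.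
Fact talg_mulDr : right_distributive talg_mul +%R.
Proof.
move=> x y z; elim/ptens_ind: x => [|a b x IH].
  by rewrite !talg_mul0l addr0.
by rewrite !talg_mulDl IH !talg_mul_pl talg_mul1D addrACA.
Qed.
Fact talg_mul0r x : talg_mul x 0 = 0.
Proof. by apply: (addrI (talg_mul x 0)); rewrite -talg_mulDr !addr0. Qed.
Fact talg_mulA : associative talg_mul.
Proof.
move=> x y z; elim/ptens_ind: x => [|a b x IHx]; first by rewrite !talg_mul0l.
rewrite !talg_mulDl {}IHx; congr (_ + _).
elim/ptens_ind: y => [|a' b' y IHy].
  by rewrite talg_mul0l talg_mul0r talg_mul0l.
rewrite talg_mulDl !talg_mulDr talg_mulDl {}IHy; congr (_ + _).
elim/ptens_ind: z => [|a'' b'' z IHz]; first by rewrite !talg_mul0r.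
by rewrite !talg_mulDr {}IHz !talg_mulE !mulrA.
Qed.
Fact talg_mul1l : left_id talg_one talg_mul.
Proof.
elim/ptens_ind=> [|a b x IH]; first by rewrite talg_mul0r.
by rewrite talg_mulDr IH talg_mulE !mul1r.
Qed.
Fact talg_mul1r : right_id talg_one talg_mul.
Proof.
elim/ptens_ind=> [|a b x IH]; first by rewrite talg_mul0l.
by rewrite talg_mulDl IH talg_mulE !mulr1.
Qed.

HB.instance Definition _ := GRing.Zmodule_isPzRing.Build talg
  talg_mulA talg_mul1l talg_mul1r talg_mulDl talg_mulDr.

Lemma ptensM a b a' b' : ptens a b * ptens a' b' = ptens (a * a') (b * b').
Proof. exact: talg_mulE. Qed.
End TensorAlgebra.

Section OppositeAlgebra.
Context (k : fieldType) (A : algType k).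

HB.instance Definition _ := GRing.Lmodule.on (A^c : Type).

Fact opp_scalerAl (c : k) (u v : A^c) : c *: (u * v) = (c *: u : A^c) * v.
Proof. exact: (@scalerAr k A c v u). Qed.
HB.instance Definition _ := GRing.Lmodule_isLalgebra.Build k (A^c) opp_scalerAl.

Fact opp_scalerAr (c : k) (u v : A^c) : c *: (u * v) = u * (c *: v : A^c).
Proof. exact: (@scalerAl k A c v u). Qed.
HB.instance Definition _ := GRing.Lalgebra_isAlgebra.Build k (A^c) opp_scalerAr.
End OppositeAlgebra.

Definition enveloping (k : fieldType) (A : algType k) : pzRingType :=
  talg A (A^c).

Section Bimodule.
Context (k : fieldType) (A : algType k).
Local Notation Ae := (enveloping A).

Definition env_tens (a b : A) : Ae := ptens a (b : A^c).

Lemma env_tensM a b a' b' :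
  env_tens a b * env_tens a' b' = env_tens (a * a') (b' * b).
Proof. exact: ptensM. Qed.

Lemma env_ind (P : Ae -> Prop) :
  P 0 -> (forall a b x, P x -> P (env_tens a b + x)) -> forall x, P x.
Proof. exact: ptens_ind. Qed.

(* A as a left module over A (x) A^op, with (a (x) b) c = a c b. *)
Definition env_lmod : Type := A.
HB.instance Definition _ := GRing.Zmodule.on env_lmod.

Fact env_lact_balanced (c : A) :
  balanced (M := vs_rmod A) (N := A^c) (fun a (b : A) => a * c * b).
Proof.
split=> [b d u v|a u v|a d b] /=.
- by rewrite !mulrDl -!scalerAl.
- by rewrite mulrDr.
- by rewrite -!scalerAl -scalerAr.
Qed.

Definition env_lact (x : Ae) (c : env_lmod) : env_lmod :=
  tlift (env_lact_balanced c) x.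

Lemma env_lactE a b c : env_lact (env_tens a b) c = a * c * b :> A.
Proof. exact: tlift_tens. Qed.

Fact env_lactDl c : {morph env_lact^~ c : x y / x + y}.
Proof. by move=> x y; exact: raddfD. Qed.
Fact env_lact0l c : env_lact 0 c = 0.
Proof. exact: raddf0. Qed.
Fact env_lactDr : right_distributive env_lact +%R.
Proof.
move=> x c d; elim/env_ind: x => [|a b x IH].
  by rewrite !env_lact0l addr0.
rewrite !env_lactDl IH addrACA; congr (_ + _).
by rewrite !env_lactE mulrDr mulrDl.
Qed.
Fact env_lact0r x : env_lact x 0 = 0.
Proof. by apply: (addrI (env_lact x 0)); rewrite -env_lactDr !addr0. Qed.
Fact env_lactA x y c : env_lact x (env_lact y c) = env_lact (x * y) c.
Proof.
elim/env_ind: x => [|a b x IH]; first by rewrite mul0r !env_lact0l.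
rewrite mulrDl !env_lactDl {}IH; congr (_ + _).
elim/env_ind: y => [|a' b' y IH]; first by rewrite mulr0 !env_lact0l env_lact0r.
rewrite mulrDr !env_lactDl env_lactDr {}IH; congr (_ + _).
by rewrite env_tensM !env_lactE !mulrA.
Qed.
Fact env_lact1 : left_id 1 env_lact.
Proof. by move=> c; rewrite [LHS](env_lactE 1 1 c) mul1r mulr1. Qed.

HB.instance Definition _ := GRing.Zmodule_isLmodule.Build Ae env_lmod
  env_lactA env_lact1 env_lactDr env_lactDl.

(* A as a right module over A (x) A^op, with c (a (x) b) = b c a. *)
Fact env_ract_balanced (c : A) :
  balanced (M := vs_rmod A) (N := A^c) (fun a (b : A) => b * c * a).
Proof.
split=> [b d u v|a u v|a d b] /=.
- by rewrite mulrDr -scalerAr.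
- by rewrite !mulrDl.
- by rewrite -!scalerAl -scalerAr.
Qed.

Definition env_ract (c : A) (x : Ae) : A := tlift (env_ract_balanced c) x.

Lemma env_ractE a b c : env_ract c (env_tens a b) = b * c * a.
Proof. exact: tlift_tens. Qed.

Fact env_ractDr c : {morph env_ract c : x y / x + y}.
Proof. by move=> x y; exact: raddfD. Qed.
Fact env_ract0r c : env_ract c 0 = 0.
Proof. exact: raddf0. Qed.
Fact env_ract_linear x : linear (env_ract^~ x).
Proof.
move=> e c d; elim/env_ind: x => [|a b x IH].
  by rewrite !env_ract0r scaler0 addr0.
rewrite !env_ractDr IH scalerDr addrACA; congr (_ + _).
by rewrite !env_ractE mulrDr mulrDl -scalerAr -scalerAl.
Qed.
Fact env_ract0l x : env_ract 0 x = 0.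
Proof.
have := env_ract_linear x 1 0 0; rewrite /= !scale1r addr0 => h.
by apply: (addrI (env_ract 0 x)); rewrite addr0 -h.
Qed.
Fact env_ractDl x : {morph env_ract^~ x : c d / c + d}.
Proof. by move=> c d; have := env_ract_linear x 1 c d; rewrite !scale1r. Qed.
Fact env_ractA c x y : env_ract c (x * y) = env_ract (env_ract c x) y.
Proof.
elim/env_ind: x => [|a b x IH]; first by rewrite mul0r !env_ract0r env_ract0l.
rewrite mulrDl !env_ractDr env_ractDl {}IH; congr (_ + _).
elim/env_ind: y => [|a' b' y IH]; first by rewrite mulr0 !env_ract0r.
rewrite mulrDr !env_ractDr {}IH; congr (_ + _).
by rewrite env_tensM !env_ractE !mulrA.
Qed.
Fact env_ract1 c : env_ract c 1 = c.
Proof. by rewrite [LHS](env_ractE 1 1 c) mul1r mulr1. Qed.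

Definition env_rmod : rmodType k Ae :=
  RMod env_ract_linear env_ractDr env_ractA env_ract1.
End Bimodule.

Section TensorMap.
Context (k : fieldType) (E : pzRingType) (M : rmodType k E).
Context (N N' : lmodType E) (f : {linear N -> N'}).

Fact tmap_balanced : balanced (M := M) (fun m n => tens m (f n)).
Proof.
have [tl tr te] := tens_balanced M N'.
split=> [n|m n n'|m e n] /=; first exact: tl.
- by rewrite raddfD; apply: tr.
- by rewrite linearZ; apply: te.
Qed.

Definition tmap : {linear tensor M N -> tensor M N'} := tlift tmap_balanced.
End TensorMap.

Section Homology.
Context (k : nzRingType) (U V W : lmodType k).
Context (f : {linear U -> V}) (g : {linear V -> W}).

Definition cycle_pred : {pred V} := fun v => g v == 0.
Fact cycle_pred_closed : GRing.submod_closed cycle_pred.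
Proof.
split=> [|c u v]; rewrite /cycle_pred !unfold_in ?raddf0 //.
by rewrite linearP => /eqP-> /eqP->; rewrite scaler0 addr0.
Qed.
HB.instance Definition _ :=
  GRing.isSubmodClosed.Build k V cycle_pred cycle_pred_closed.

Record cycles := Cycle { cycle_val : V; _ : cycle_val \in cycle_pred }.
HB.instance Definition _ := [isSub for cycle_val].
HB.instance Definition _ := [Choice of cycles by <:].
HB.instance Definition _ := [SubChoice_isSubLmodule of cycles by <:].

Definition boundary_pred : {pred cycles} :=
  fun z => `[< exists u, f u = cycle_val z >].
Fact boundary_pred_closed : GRing.submod_closed boundary_pred.
Proof.
split; first by apply/asboolP; exists 0; rewrite !raddf0.
move=> c x y /asboolP[u fu] /asboolP[v fv]; apply/asboolP.
exists (c *: u + v); rewrite linearP fu fv.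
exact: esym (linearP (\val : {linear cycles -> V}) c x y).
Qed.
HB.instance Definition _ :=
  GRing.isSubmodClosed.Build k cycles boundary_pred boundary_pred_closed.

(* ker g / im f; the composite g \o f need not vanish, in which case im f means
   its intersection with ker g. *)
Definition homology : lmodType k := lquot boundary_pred.
End Homology.

Definition projective (E : pzRingType) (P : lmodType E) : Prop :=
  forall (X Y : lmodType E) (g : {linear X -> Y}) (f : {linear P -> Y}),
    (forall y, exists x, g x = y) ->
    exists h : {linear P -> X}, forall p, g (h p) = f p.

Record projResolution (E : pzRingType) (N : lmodType E) := ProjResolution {
  res_obj :> nat -> lmodType E;
  res_diff : forall n, {linear res_obj n.+1 -> res_obj n};
  res_aug : {linear res_obj 0 -> N};
  res_projective : forall n, projective (res_obj n);
  res_aug_surj : forall y, exists x, res_aug x = y;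
  res_exact0 : forall x, res_aug x = 0 <-> exists y, res_diff 0 y = x;
  res_exactS : forall n x,
    res_diff n x = 0 <-> exists y, res_diff n.+1 y = x }.

Section Tor.
Context (k : fieldType) (E : pzRingType) (M : rmodType k E) (N : lmodType E).
Context (P : projResolution N).

Definition tor_diff (n : nat) : {linear tensor M (P n) -> tensor M (P n.-1)} :=
  match n with
  | 0 => \0 : {linear tensor M (P 0) -> tensor M (P 0)}
  | m.+1 => tmap M (res_diff P m)
  end.

(* Tor_n(M, N), computed from the projective resolution P of N. *)
Definition Tor (n : nat) : lmodType k := homology (tor_diff n.+1) (tor_diff n).
End Tor.

(* HH_n(A), computed from a projective resolution P of A over A (x) A^op. *)
Definition HH (k : fieldType) (A : algType k)
    (P : projResolution (env_lmod A)) (n : nat) : lmodType k :=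
  Tor (env_rmod A) P n.

(* k[x] (x) k[y], both factors being {poly k}; q is a phantom parameter that
   selects the algebra structure put on this vector space below. *)
Definition qplane (k : fieldType) (q : k) : Type :=
  tensor (vs_rmod {poly k}) {poly k}.

Section QuantumPlane.
Context (k : fieldType) (q : k).
Local Notation kx := {poly k}.

HB.instance Definition _ := GRing.Lmodule.on (qplane q).

Definition qtens (f g : kx) : qplane q := tens (M := vs_rmod kx) f g.

Lemma qtens_linearl g : linear (qtens^~ g).
Proof. by have [fl _ _] := tens_balanced (vs_rmod kx) kx; exact: fl. Qed.
Lemma qtensDl f f' g : qtens (f + f') g = qtens f g + qtens f' g.
Proof. by have := qtens_linearl g 1 f f'; rewrite /= !scale1r. Qed.
Lemma qtens0l g : qtens 0 g = 0.
Proof. by apply: (addrI (qtens 0 g)); rewrite -qtensDl !addr0. Qed.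
Lemma qtensZl c f g : qtens (c *: f) g = c *: qtens f g.
Proof. by have := qtens_linearl g c f 0; rewrite /= qtens0l !addr0. Qed.
Lemma qtensDr f g g' : qtens f (g + g') = qtens f g + qtens f g'.
Proof.
by have [_ fr _] := tens_balanced (vs_rmod kx) kx; exact: (fr f g g').
Qed.
Lemma qtens0r f : qtens f 0 = 0.
Proof. by apply: (addrI (qtens f 0)); rewrite -qtensDr !addr0. Qed.
Lemma qtensZr c f g : qtens f (c *: g) = c *: qtens f g.
Proof.
have [_ _ fe] := tens_balanced (vs_rmod kx) kx.
by rewrite -qtensZl; exact: esym (fe f c g).
Qed.
Lemma qtens_suml (I : Type) (r : seq I) (F : I -> kx) g :
  qtens (\sum_(i <- r) F i) g = \sum_(i <- r) qtens (F i) g.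
Proof.
elim: r => [|i r IH]; first by rewrite !big_nil qtens0l.
by rewrite !big_cons qtensDl IH.
Qed.

Definition qtwist (j : nat) (f : kx) : kx := f \Po (q ^+ j *: 'X).

(* The product (f (x) g)(f' (x) g'): moving y^j past f'(x) gives f'(q^j x) y^j,
   that is, y^j x^i = q^(i j) x^i y^j. *)
Definition qmul2 (f g f' g' : kx) : qplane q :=
  \sum_(j < size g) g`_j *: qtens (f * qtwist j f') ('X^j * g').

Lemma qmul2_widen n (f g f' g' : kx) : (size g <= n)%N ->
  qmul2 f g f' g' = \sum_(j < n) g`_j *: qtens (f * qtwist j f') ('X^j * g').
Proof.
move=> gn; rewrite /qmul2 (big_ord_widen _ (fun j : nat =>
  g`_j *: qtens (f * qtwist j f') ('X^j * g')) gn).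
rewrite big_mkcond; apply: eq_bigr => j _ /=; case: ltnP => // gj.
by rewrite nth_default ?scale0r.
Qed.

Fact qmul2_balancedr f g : balanced (M := vs_rmod kx) (qmul2 f g).
Proof.
split=> [g' c u v|f' u v|f' c g'] /=; rewrite /qmul2.
- rewrite scaler_sumr -big_split /=; apply: eq_bigr => j _.
  rewrite /qtwist comp_polyD comp_polyZ mulrDr -scalerAr qtensDl qtensZl.
  by rewrite scalerDr !scalerA mulrC.
- rewrite -big_split /=; apply: eq_bigr => j _.
  by rewrite mulrDr qtensDr scalerDr.
- apply: eq_bigr => j _; congr (_ *: _).
  by rewrite /qtwist comp_polyZ -!scalerAr qtensZl qtensZr.
Qed.

Definition qmul1 (f g : kx) (y : qplane q) : qplane q :=
  tlift (qmul2_balancedr f g) y.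

Lemma qmul1E f g f' g' : qmul1 f g (qtens f' g') = qmul2 f g f' g'.
Proof. exact: tlift_tens. Qed.
Lemma qmul1D f g : {morph qmul1 f g : x y / x + y}.
Proof. by move=> x y; exact: raddfD. Qed.
Lemma qmul10 f g : qmul1 f g 0 = 0.
Proof. exact: raddf0. Qed.
Lemma qmul1Z f g c : {morph qmul1 f g : x / c *: x}.
Proof. by move=> x; exact: linearZ_LR. Qed.

Lemma qplane_ind0 (P : qplane q -> Prop) :
  P 0 -> (forall f g x, P x -> P (qtens f g + x)) -> forall x, P x.
Proof. exact: (@tens_ind k k (vs_rmod kx) kx P). Qed.

Lemma qplane_ind (P : qplane q -> Prop) :
  P 0 -> (forall f j x, P x -> P (qtens f 'X^j + x)) -> forall x, P x.
Proof.
move=> P0 PD; elim/qplane_ind0 => // f g x Px.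
rewrite -[g]coefK poly_def; elim: (index_enum _) => [|j r IH].
  by rewrite big_nil qtens0r add0r.
by rewrite big_cons qtensDr qtensZr -qtensZl -addrA; apply: PD.
Qed.

Fact qmul_balanced (y : qplane q) :
  balanced (M := vs_rmod kx) (fun f g => qmul1 f g y).
Proof.
split=> [g c u v|f u v|f c g] /=; elim/qplane_ind0: y => [|f' g' y IH].
- by rewrite !qmul10 scaler0 addr0.
- rewrite !qmul1D !qmul1E IH scalerDr addrACA; congr (_ + _).
  rewrite /qmul2 scaler_sumr -big_split /=; apply: eq_bigr => j _.
  by rewrite mulrDl -scalerAl qtensDl qtensZl scalerDr !scalerA mulrC.
- by rewrite !qmul10 addr0.
- rewrite !qmul1D !qmul1E IH addrACA; congr (_ + _).
  have su : (size u <= maxn (size u) (size v))%N by rewrite leq_maxl.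
  have sv : (size v <= maxn (size u) (size v))%N by rewrite leq_maxr.
  rewrite (qmul2_widen _ _ _ su) (qmul2_widen _ _ _ sv).
  rewrite (qmul2_widen _ _ _ (size_polyD u v)) -big_split /=.
  by apply: eq_bigr => j _; rewrite coefD scalerDl.
- by rewrite !qmul10.
- rewrite !qmul1D !qmul1E IH; congr (_ + _).
  rewrite (qmul2_widen _ _ _ (size_scale_leq c g)) /qmul2.
  apply: eq_bigr => j _.
  by rewrite coefZ -scalerAl qtensZl scalerA mulrC.
Qed.

Definition qmul (x y : qplane q) : qplane q := tlift (qmul_balanced y) x.

Lemma qmulE f g f' g' : qmul (qtens f g) (qtens f' g') = qmul2 f g f' g'.
Proof. by rewrite [LHS]tlift_tens qmul1E. Qed.

Lemma qmulXE f j f' g' :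
  qmul (qtens f 'X^j) (qtens f' g') = qtens (f * qtwist j f') ('X^j * g').
Proof.
rewrite qmulE /qmul2 size_polyXn big_ord_recr /= big1 ?add0r.
  by rewrite coefXn eqxx scale1r.
by move=> i _; rewrite coefXn ltn_eqF ?scale0r.
Qed.

Fact qmulDl : left_distributive qmul +%R.
Proof. by move=> x y z; exact: raddfD. Qed.
Fact qmul0l x : qmul 0 x = 0.
Proof. exact: raddf0. Qed.
Fact qmulZl c x y : c *: qmul x y = qmul (c *: x) y.
Proof. exact/esym/linearZ_LR. Qed.
Fact qmulDr : right_distributive qmul +%R.
Proof.
move=> x y z; elim/qplane_ind0: x => [|f g x IH].
  by rewrite !qmul0l addr0.
rewrite !qmulDl {}IH addrACA; congr (_ + _).
by rewrite /qmul !tlift_tens qmul1D.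
Qed.
Fact qmul0r x : qmul x 0 = 0.
Proof. by apply: (addrI (qmul x 0)); rewrite -qmulDr !addr0. Qed.
Fact qmulZr c x y : c *: qmul x y = qmul x (c *: y).
Proof.
elim/qplane_ind0: x => [|f g x IH]; first by rewrite !qmul0l scaler0.
rewrite !qmulDl scalerDr {}IH; congr (_ + _).
by rewrite /qmul !tlift_tens qmul1Z.
Qed.

Lemma qtwistM j f g : qtwist j (f * g) = qtwist j f * qtwist j g.
Proof. exact: comp_polyM. Qed.
Lemma qtwist_add i j f : qtwist i (qtwist j f) = qtwist (i + j) f.
Proof.
rewrite /qtwist -comp_polyA comp_polyZ comp_polyX scalerA -exprD.
by rewrite addnC.
Qed.
Lemma qtwist0 f : qtwist 0 f = f.
Proof. by rewrite /qtwist expr0 scale1r comp_polyXr. Qed.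
Lemma qtwist1 j : qtwist j 1 = 1.
Proof. exact: comp_polyC. Qed.

Fact qmulA : associative qmul.
Proof.
move=> x y z; elim/qplane_ind: x => [|f i x IHx]; first by rewrite !qmul0l.
rewrite !qmulDl {}IHx; congr (_ + _).
elim/qplane_ind: y => [|f' j y IHy]; first by rewrite qmul0l qmul0r qmul0l.
rewrite qmulDl !qmulDr qmulDl {}IHy; congr (_ + _).
elim/qplane_ind: z => [|f'' l z IHz]; first by rewrite !qmul0r.
rewrite !qmulDr {}IHz; congr (_ + _).
by rewrite !qmulXE -!exprD qmulXE qtwistM qtwist_add -exprD !mulrA addnA.
Qed.

Definition qone : qplane q := qtens 1 1.

Fact qmul1l : left_id qone qmul.
Proof.
elim/qplane_ind=> [|f j x IH]; first by rewrite qmul0r.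
rewrite qmulDr {}IH; congr (_ + _).
by rewrite [LHS](qmulXE 1 0 f 'X^j) qtwist0 !mul1r.
Qed.
Fact qmul1r : right_id qone qmul.
Proof.
elim/qplane_ind=> [|f j x IH]; first by rewrite qmul0l.
by rewrite qmulDl {}IH qmulXE qtwist1 !mulr1.
Qed.

Fact qcounit_balanced :
  balanced (M := vs_rmod kx) (fun f g : kx => f`_0 * g`_0 : k^o).
Proof.
split=> [g c u v|f u v|f c g] /=.
- by rewrite coefD coefZ mulrDl -mulrA.
- by rewrite coefD mulrDr.
- by rewrite !coefZ mulrCA mulrA.
Qed.
Fact qone_neq0 : qone != 0.
Proof.
apply/eqP => /(congr1 (tlift qcounit_balanced)); rewrite raddf0 tlift_tens.
by rewrite coefC mulr1 => /eqP; rewrite oner_eq0.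
Qed.

HB.instance Definition _ := GRing.Zmodule_isNzRing.Build (qplane q)
  qmulA qmul1l qmul1r qmulDl qmulDr qone_neq0.
HB.instance Definition _ := GRing.Lmodule_isLalgebra.Build k (qplane q) qmulZl.
HB.instance Definition _ := GRing.Lalgebra_isAlgebra.Build k (qplane q) qmulZr.

Lemma qtens_mul f g : qtens f 1 * qtens 1 g = qtens f g :> qplane q.
Proof. by rewrite [LHS](qmulXE f 0 1 g) qtwist1 mulr1 mul1r. Qed.
Lemma qplane_xM f f' : qtens f 1 * qtens f' 1 = qtens (f * f') 1 :> qplane q.
Proof. by rewrite [LHS](qmulXE f 0 f' 1) qtwist0 mul1r. Qed.
Lemma qplane_yx i j :
  qtens 1 'X^j * qtens 'X^i 1 = q ^+ (i * j) *: qtens 'X^i 'X^j :> qplane q.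
Proof.
rewrite [LHS]qmulXE mul1r mulr1 -qtensZl; congr (qtens _ _).
elim: i => [|i IH]; first by rewrite expr0 qtwist1 mul0n scale1r.
rewrite exprS qtwistM {}IH /qtwist comp_polyX -scalerAr -scalerAl scalerA.
by rewrite -exprD mulSn addnC.
Qed.
End QuantumPlane.

Section Values.
Context (k : fieldType).

(* The ideal y k[y] of k[y] *)
Definition polymulX_pred : {pred {poly k}} := fun p => 'X %| p.
Fact polymulX_pred_closed : GRing.submod_closed polymulX_pred.
Proof.
split=> [|c u v]; rewrite !unfold_in; first exact: dvdp0.
by move=> Xu Xv; rewrite dvdp_add // -mul_polyC dvdp_mull.
Qed.
HB.instance Definition _ :=
  GRing.isSubmodClosed.Build k {poly k} polymulX_pred polymulX_pred_closed.

Record polymulX :=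
  PolyMulX { polymulX_val : {poly k}; _ : polymulX_val \in polymulX_pred }.
HB.instance Definition _ := [isSub for polymulX_val].
HB.instance Definition _ := [Choice of polymulX by <:].
HB.instance Definition _ := [SubChoice_isSubLmodule of polymulX by <:].

Definition HH_qplane (n : nat) : lmodType k :=
  match n with
  | 0 => ({poly k} * polymulX)%type
  | 1 => ({poly k} * {poly k})%type
  | _ => 'rV[k]_0
  end.
End Values.

(* Main.v *)
Require Import Defs.
From HB Require Import structures.
From mathcomp Require Import all_boot all_algebra.
From mathcomp Require Import boolp.

Set Implicit Arguments.
Unset Strict Implicit.
Unset Printing Implicit Defensive.

Import GRing.Theory.
Local Open Scope ring_scope.

(** Write A for the quantum plane and E for its enveloping algebra. Since A has
    the k-basis x^i y^j and the single relation y x = q x y, it has a Koszul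
    resolution of length two by free E-modules,
      0 -> E -> E^2 -> E -> A -> 0,
    whose maps are right multiplications by elements of E:
      (u, v) |-> u (x#1 - 1#x) + v (y#1 - 1#y),
      w |-> (w (y#1 - q 1#y), w (1#x - q x#1)),
    where a#b is the pure tensor a (x) b. Exactness is witnessed by an explicit
    homotopy built from partial derivatives of a normally ordered word, the
    operators [xder 1] and [yder], and from their q-deformation [xder q]; they
    satisfy the three identities [der_contract], [xder_contract] and
    [yder_contract], each proved by induction on the word.

    Tor does not depend on the projective resolution ([Tor_iso], by comparison
    of resolutions), so the Hochschild homology is that of the complex
      0 -> A -> A^2 -> A -> 0
    with differentials m |-> (m y - q y m, x m - q m x) and
    (u, v) |-> (u x - x u) + (v y - y v). On monomials these maps multiply by
    1 - q^(i+1), 1 - q^(j+1), q^j - 1 and 1 - q^i. As q is not a root of unity,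
    the first two never vanish, the third only for j = 0 and the last only for
    i = 0. Hence the complex retracts onto its part spanned by the pure powers
    of x and of y: the classes x^i and y^j (with 1 counted once) in degree 0,
    the classes x^i dx and y^j dy in degree 1, and nothing in degree 2. The
    retraction is given by the operators [tw_y_inv] and [ad_y_inv], and
    [HH_basis] reads off the homology. *)

(** * Homology and projective resolutions *)

(** To identify a homology space with T it is enough to give a linear map on all
    chains, not only on cycles, that is onto T already on the cycles and whose
    kernel among the cycles is the space of boundaries. *)
Lemma homology_iso (k : nzRingType) (U V W T : lmodType k)
    (f : {linear U -> V}) (g : {linear V -> W}) (p : {linear V -> T}) :
  (forall t, exists2 v, g v = 0 & p v = t) ->
  (forall v, g v = 0 -> p v = 0 <-> exists u, f u = v) ->
  lmod_iso (homology f g) T.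
Proof.
move=> p_surj p_ker.
have valK (z : cycles g) : g (val z) = 0 by apply/eqP; exact: (valP z).
pose p0 : {linear cycles g -> T} := p \o val.
have p0S (z : cycles g) : z \in @boundary_pred _ _ _ _ f g -> p0 z = 0.
  by move=> /asboolP zB; apply/(p_ker _ (valK z)).
pose h : homology f g -> T := lquot_lift p0.
have hE z : h (lproj _ z) = p0 z by exact: lquot_lift_proj.
have h_lin : linear h by exact: lquot_lift_is_linear.
pose hl : {linear homology f g -> T} :=
  HB.pack h (GRing.isLinear.Build k (homology f g) T _ h h_lin).
have h_inj : injective hl.
  apply: raddf_inj => x; rewrite -[x]lreprK => hx0.
  apply/eqP; rewrite -(linear0 (lproj _)) lprojE subr0.
  apply/asboolP; apply/(p_ker _ (valK _)).
  by rewrite -[LHS]hE.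
have h_surj t : exists x, hl x = t.
  have [v gv pv] := p_surj t.
  have vC : v \in cycle_pred g by apply/eqP.
  by exists (lproj _ (Cycle vC)); rewrite -pv; exact: (hE (Cycle vC)).
exists hl.
have inv_ex : forall t, {x | hl x = t} by move=> t; apply: cid.
exists (fun t => sval (inv_ex t)) => [x|t].
  by apply: h_inj; case: (inv_ex _).
by case: (inv_ex _).
Qed.

Section Image.
Context (E : pzRingType) (X Y : lmodType E) (g : {linear X -> Y}).

Definition image_pred : {pred Y} := fun y => `[< exists x, g x = y >].
Fact image_pred_closed : GRing.submod_closed image_pred.
Proof.
split; first by apply/asboolP; exists 0; rewrite linear0.
move=> c u v /asboolP[x gx] /asboolP[y gy]; apply/asboolP.
by exists (c *: x + y); rewrite linearP gx gy.
Qed.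
HB.instance Definition _ :=
  GRing.isSubmodClosed.Build E Y image_pred image_pred_closed.

Record image_of := ImageOf { image_val : Y; _ : image_val \in image_pred }.
HB.instance Definition _ := [isSub for image_val].
HB.instance Definition _ := [Choice of image_of by <:].
HB.instance Definition _ := [SubChoice_isSubLmodule of image_of by <:].

Section Corestriction.
Context (Z : lmodType E) (f : {linear Z -> Y}).
Hypothesis f_im : forall z, f z \in image_pred.

Definition corestr (z : Z) : image_of := ImageOf (f_im z).
Fact corestr_is_linear : linear corestr.
Proof.
move=> c u v; apply: val_inj; rewrite linearP /=.
by rewrite linearP.
Qed.
HB.instance Definition _ :=
  GRing.isLinear.Build E Z image_of _ corestr corestr_is_linear.
End Corestriction.

(** Lifting through a map g that need not be onto: g is replaced by its
    corestriction to its image, where the defining property applies. *)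
Lemma projective_lift (P : lmodType E) (f : {linear P -> Y}) :
  projective P -> (forall p, exists x, g x = f p) ->
  exists h : {linear P -> X}, forall p, g (h p) = f p.
Proof.
move=> prP fg.
have f_im p : f p \in image_pred by apply/asboolP; exact: fg.
have g_im x : g x \in image_pred by apply/asboolP; exists x.
have [|h hP] := prP _ _ (corestr g_im) (corestr f_im).
  move=> y; have /asboolP[x gx] := valP y.
  by exists x; apply: val_inj.
by exists h => p; have := congr1 val (hP p).
Qed.
End Image.

(** Dependent choice along a family of types, with an invariant G that says that
    a partial construction can be continued. Chain maps and homotopies are
    built degree by degree with it. *)
Lemma dependent_sequence (T : nat -> Type) (R : forall n, T n -> T n.+1 -> Prop)
    (G : forall n, T n -> Prop) (x0 : T 0%N) :
  G 0%N x0 -> (forall n x, G n x -> exists2 y, R n x y & G n.+1 y) ->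
  exists2 f : forall n, T n, f 0%N = x0 & forall n, R n (f n) (f n.+1).
Proof.
move=> G0 step.
have step' n (x : {x | G n x}) : {y : {y | G n.+1 y} | R n (sval x) (sval y)}.
  apply: cid; case: x => x /step[y Rxy Gy] /=; by exists (exist _ y Gy).
pose F := fix F n : {x | G n x} :=
  if n is m.+1 then sval (step' m (F m)) else exist _ x0 G0.
exists (fun n => sval (F n)) => // n.
exact: (svalP (step' n (F n))).
Qed.

Section Comparison.
Context (E : pzRingType) (N : lmodType E).
Implicit Types P Q : projResolution N.

Lemma res_diff_aug P y : res_aug P (res_diff P 0%N y) = 0.
Proof. by apply/res_exact0; exists y. Qed.

Lemma res_diff_diff P n y : res_diff P n (res_diff P n.+1 y) = 0.
Proof. by apply/res_exactS; exists y. Qed.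

Definition chain_map P Q (phi : forall n, {linear P n -> Q n}) :=
  forall n x, res_diff Q n (phi n.+1 x) = phi n (res_diff P n x).

(** The invariant carried along the construction is that the current component
    sends boundaries to boundaries, which is exactly what lets it be lifted to
    the next degree. *)
Lemma comparison_map P Q :
  exists phi : forall n, {linear P n -> Q n},
    chain_map phi /\ forall x, res_aug Q (phi 0%N x) = res_aug P x.
Proof.
have [phi0 phi0P] : exists h : {linear P 0%N -> Q 0%N},
    forall x, res_aug Q (h x) = res_aug P x.
  by apply: (@projective_lift _ _ _ (res_aug Q)) => [|x];
    [exact: res_projective | exact: res_aug_surj].
pose G n (phi : {linear P n -> Q n}) :=
  forall y, exists x, res_diff Q n x = phi (res_diff P n y).
pose R n (phi : {linear P n -> Q n}) (phi' : {linear P n.+1 -> Q n.+1}) :=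
  forall x, res_diff Q n (phi' x) = phi (res_diff P n x).
have [|n a Ga|phi e phiR] := @dependent_sequence _ R G phi0.
- by move=> y; apply/res_exact0; rewrite phi0P res_diff_aug.
- have [b bP] := @projective_lift _ _ _ (res_diff Q n) _ (a \o res_diff P n)
    (@res_projective _ _ P n.+1) Ga.
  exists b => // y; apply/res_exactS; rewrite bP /=.
  by rewrite res_diff_diff linear0.
- by exists phi; split=> // x; rewrite e.
Qed.

(** What the homotopy still has to bound in degree n + 1, namely phi - s d,
    takes its values in the cycles, hence in the boundaries by exactness. *)
Lemma null_homotopy P Q (phi : forall n, {linear P n -> Q n}) :
  chain_map phi -> (forall x, res_aug Q (phi 0%N x) = 0) ->
  exists s : forall n, {linear P n -> Q n.+1},
    (forall x, res_diff Q 0%N (s 0%N x) = phi 0%N x) /\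
    forall n x, res_diff Q n.+1 (s n.+1 x) =
      phi n.+1 x - s n (res_diff P n x).
Proof.
move=> phiC phi0.
have [s0 s0P] : exists h : {linear P 0%N -> Q 1%N},
    forall x, res_diff Q 0%N (h x) = phi 0%N x.
  apply: (@projective_lift _ _ _ (res_diff Q 0%N)) => [|x].
    exact: res_projective.
  by apply/res_exact0.
pose G n (s : {linear P n -> Q n.+1}) :=
  forall y, exists x, res_diff Q n.+1 x = phi n.+1 y - s (res_diff P n y).
pose R n (s : {linear P n -> Q n.+1}) (s' : {linear P n.+1 -> Q n.+2}) :=
  forall x, res_diff Q n.+1 (s' x) = phi n.+1 x - s (res_diff P n x).
have [|n a Ga|s e sR] := @dependent_sequence _ R G s0.
- by move=> y; apply/res_exactS; rewrite linearB s0P phiC subrr.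
- have [b bP] := @projective_lift _ _ _ (res_diff Q n.+1) _
    (phi n.+1 \- (a \o res_diff P n)) (@res_projective _ _ P n.+1) Ga.
  exists b => // y; apply/res_exactS; rewrite linearB bP /= phiC.
  by rewrite res_diff_diff linear0 subr0 subrr.
- by exists s; split=> // x; rewrite e.
Qed.
End Comparison.

(** * Tor from an arbitrary projective resolution *)
Section TensorTheory.
Context (k : fieldType) (E : pzRingType) (M : rmodType k E).

Lemma ractDl (e : E) : {morph (fun m : M => ract m e) : m m' / m + m'}.
Proof. by move=> m m'; have := ract_linear e 1 m m'; rewrite !scale1r. Qed.

Lemma ract0l (e : E) : ract (0 : M) e = 0.
Proof. by apply: (addrI (ract (0 : M) e)); rewrite -ractDl !addr0. Qed.

Lemma ract0r (m : M) : ract m 0 = 0.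
Proof. by apply: (addrI (ract m 0)); rewrite -ractDr !addr0. Qed.

Lemma ractB (m : M) (e e' : E) : ract m (e - e') = ract m e - ract m e'.
Proof. by apply/eqP; rewrite eq_sym subr_eq -ractDr subrK. Qed.

Lemma tens_addl (N : lmodType E) (n : N) :
  {morph (fun m : M => tens m n) : m m' / m + m'}.
Proof.
move=> m m'; have [tl _ _] := tens_balanced M N.
by have := tl n 1 m m'; rewrite !scale1r.
Qed.

Lemma tens_addr (N : lmodType E) (m : M) :
  {morph (fun n : N => tens m n) : n n' / n + n'}.
Proof. by have [_ tr _] := tens_balanced M N; exact: tr. Qed.

Lemma tens_ract (N : lmodType E) (m : M) e (n : N) :
  tens (ract m e) n = tens m (e *: n).
Proof. by have [_ _ te] := tens_balanced M N; exact: te. Qed.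

Lemma tens_zerol (N : lmodType E) (n : N) : tens (0 : M) n = 0.
Proof. by apply: (addrI (tens (0 : M) n)); rewrite -tens_addl !addr0. Qed.

Lemma tmap_tens (N N' : lmodType E) (f : {linear N -> N'}) (m : M) n :
  tmap M f (tens m n) = tens m (f n).
Proof. exact: tlift_tens. Qed.

Lemma tensor_ext (N : lmodType E) (W : lmodType k)
    (f g : {linear tensor M N -> W}) :
  (forall m n, f (tens m n) = g (tens m n)) -> f =1 g.
Proof.
move=> fg; elim/tens_ind => [|m n x IH]; first by rewrite !linear0.
by rewrite !linearD fg IH.
Qed.

Lemma eq_tmap (N N' : lmodType E) (f g : {linear N -> N'}) :
  f =1 g -> tmap M f =1 tmap M g.
Proof. by move=> fg; apply: tensor_ext => m n; rewrite !tmap_tens fg. Qed.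

Lemma tmap_id (N : lmodType E) (f : {linear N -> N}) :
  f =1 id -> tmap M f =1 id.
Proof.
by move=> fid; apply: (@tensor_ext _ _ _ idfun) => m n; rewrite tmap_tens fid.
Qed.

Lemma tmap_comp (N N' N'' : lmodType E) (f : {linear N' -> N''})
    (g : {linear N -> N'}) (x : tensor M N) :
  tmap M (f \o g) x = tmap M f (tmap M g x).
Proof.
elim/tens_ind: x => [|m n x IH]; first by rewrite !linear0.
by rewrite !linearD IH !tmap_tens.
Qed.

Lemma tmapD (N N' : lmodType E) (f g : {linear N -> N'}) (x : tensor M N) :
  tmap M (f \+ g) x = tmap M f x + tmap M g x.
Proof.
elim/tens_ind: x => [|m n x IH]; first by rewrite !linear0 addr0.
by rewrite !linearD IH addrACA !tmap_tens tens_addr.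
Qed.

Lemma tmap0 (N N' : lmodType E) (f : {linear N -> N'}) :
  (forall x, f x = 0) -> forall x : tensor M N, tmap M f x = 0.
Proof.
move=> f0 x; have := tmapD f f x.
rewrite (@eq_tmap _ _ (f \+ f) f) => [/eqP|y /=]; last by rewrite f0 addr0.
by rewrite -subr_eq0 opprD addNKr oppr_eq0 => /eqP.
Qed.
End TensorTheory.

Section TorComparison.
Context (k : fieldType) (E : pzRingType) (M : rmodType k E) (N : lmodType E).
Implicit Types P Q : projResolution N.

Lemma tor_diff0 P x : tor_diff M P 0%N x = 0.
Proof. by []. Qed.

Lemma tor_diffS P n (x : tensor M (P n.+1)) :
  tor_diff M P n.+1 x = tmap M (res_diff P n) x.
Proof. by []. Qed.

Lemma tor_diff_diff P n x : tor_diff M P n (tor_diff M P n.+1 x) = 0.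
Proof.
case: n x => [|n] x; first exact: tor_diff0.
rewrite !tor_diffS -tmap_comp; apply: tmap0 => y.
exact: res_diff_diff.
Qed.

Lemma tor_chain_map P Q (phi : forall n, {linear P n -> Q n}) n x :
  chain_map phi ->
  tor_diff M Q n (tmap M (phi n) x) = tmap M (phi n.-1) (tor_diff M P n x).
Proof.
move=> phiC; case: n x => [|n] x; first by rewrite !tor_diff0 linear0.
rewrite !tor_diffS -!tmap_comp; apply: eq_tmap => y; exact: phiC.
Qed.

(** A chain map lifting the identity is homotopic to the identity, and the
    homotopy survives tensoring with M; on a cycle only its boundary term is
    left. *)
Lemma tor_homotopy P (phi : forall n, {linear P n -> P n}) n x :
  chain_map phi -> (forall x, res_aug P (phi 0%N x) = res_aug P x) ->
  tor_diff M P n x = 0 ->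
  exists y, tor_diff M P n.+1 y = tmap M (phi n) x - x.
Proof.
move=> phiC phi0 dx.
pose psi m : {linear P m -> P m} := phi m \- idfun.
have [||s [s0 sS]] := @null_homotopy _ _ P P psi.
- by move=> m y; rewrite /= linearB phiC.
- by move=> y; rewrite /= linearB phi0 subrr.
exists (tmap M (s n) x); apply/eqP; rewrite eq_sym subr_eq; apply/eqP.
rewrite tor_diffS.
case: n x dx => [|n] x dx.
  rewrite -tmap_comp -[X in _ = _ + X](@tmap_id _ _ M _ idfun) // -tmapD.
  by apply: eq_tmap => y /=; rewrite s0 /= subrK.
have := congr1 (tmap M (s n)) dx; rewrite linear0 tor_diffS => sdx.
rewrite -[RHS]addr0 -sdx -!tmap_comp.
rewrite -[X in _ = _ + X + _](@tmap_id _ _ M _ idfun) // -!tmapD.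
by apply: eq_tmap => y /=; rewrite sS /= addrAC !subrK.
Qed.

(** Comparison maps P -> Q and Q -> P are mutually inverse up to homotopy, so
    the data that compute the homology of M (x) Q transport to M (x) P. *)
Lemma Tor_iso P Q (n : nat) (T : lmodType k)
    (p : {linear tensor M (Q n) -> T}) :
  (forall t, exists2 v, tor_diff M Q n v = 0 & p v = t) ->
  (forall v, tor_diff M Q n v = 0 ->
     p v = 0 <-> exists u, tor_diff M Q n.+1 u = v) ->
  lmod_iso (Tor M P n) T.
Proof.
move=> p_surj p_ker.
have [phi [phiC phi0]] := comparison_map P Q.
have [psi [psiC psi0]] := comparison_map Q P.
have pB u : p (tor_diff M Q n.+1 u) = 0.
  by apply/p_ker; [exact: tor_diff_diff | exists u].
pose p' : {linear tensor M (P n) -> T} := p \o tmap M (phi n).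
have p'E v : p' v = p (tmap M (phi n) v) by [].
apply: (@homology_iso _ _ _ _ _ _ _ p') => [t|v dv].
  have [v dv pv] := p_surj t.
  exists (tmap M (psi n) v).
    by rewrite tor_chain_map // dv linear0.
  have [||u] := @tor_homotopy Q (fun m => phi m \o psi m) n v _ _ dv.
  - by move=> m x /=; rewrite phiC psiC.
  - by move=> x /=; rewrite phi0 psi0.
  rewrite tmap_comp => /(congr1 p); rewrite pB linearB pv p'E => /esym/eqP.
  by rewrite subr_eq0 => /eqP.
have dphi : tor_diff M Q n (tmap M (phi n) v) = 0.
  by rewrite tor_chain_map // dv linear0.
rewrite p'E; split=> [/(p_ker _ dphi)[u du]|[u <-]]; last first.
  by rewrite -[tmap M (phi n) _](@tor_chain_map P Q phi n.+1 u phiC) pB.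
have [||w] := @tor_homotopy P (fun m => psi m \o phi m) n v _ _ dv.
- by move=> m x /=; rewrite psiC phiC.
- by move=> x /=; rewrite psi0 phi0.
rewrite tmap_comp -du -[tmap M (psi n) _](@tor_chain_map Q P psi n.+1 u psiC).
move=> e; exists (tmap M (psi n.+1) u - w).
by rewrite linearB e opprB addrC subrK.
Qed.
End TorComparison.

(** * Free resolutions of length two *)
Section Projective.
Context (E : pzRingType).

Lemma projective_regular : projective (E^o : lmodType E).
Proof.
move=> X Y g f g_surj; have [x0 gx0] := g_surj (f 1).
pose h (e : E^o) : X := e *: x0.
have h_lin : linear h by move=> c u v; rewrite /h scalerDl scalerA.
pose hl : {linear E^o -> X} :=
  HB.pack h (GRing.isLinear.Build E E^o X _ h h_lin).
exists hl => e.
change (g (e *: x0) = f e).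
rewrite (linearZZ g) gx0 -(linearZZ f); congr (f _); exact: mulr1.
Qed.

Lemma projective_prod (P Q : lmodType E) :
  projective P -> projective Q -> projective (P * Q)%type.
Proof.
move=> prP prQ X Y g f g_surj.
pose i1 (u : P) : (P * Q)%type := (u, 0).
pose i2 (v : Q) : (P * Q)%type := (0, v).
have i1L : linear i1 by move=> c u v; congr (_, _); rewrite /= scaler0 addr0.
have i2L : linear i2 by move=> c u v; congr (_, _); rewrite /= scaler0 addr0.
pose j1 : {linear P -> (P * Q)%type} :=
  HB.pack i1 (GRing.isLinear.Build E P (P * Q)%type _ i1 i1L).
pose j2 : {linear Q -> (P * Q)%type} :=
  HB.pack i2 (GRing.isLinear.Build E Q (P * Q)%type _ i2 i2L).
have [h1 h1P] := prP X Y g (f \o j1) g_surj.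
have [h2 h2P] := prQ X Y g (f \o j2) g_surj.
exists ((h1 \o fst) \+ (h2 \o snd)) => -[u v] /=.
rewrite linearD h1P h2P /= -linearD.
by congr (f (_, _)); [exact: addr0 | exact: add0r].
Qed.

Lemma projective_rV0 : projective 'rV[E]_0.
Proof. by move=> X Y g f _; exists \0 => p; rewrite (thinmx0 p) !linear0. Qed.
End Projective.

(** A complex 0 -> E -> E^2 -> E -> N of left E-modules is given by elements
    a, b, c, d of E acting by right multiplication and by the image n0 of 1
    in N. *)
Section LengthTwo.
Context (E : pzRingType) (N : lmodType E) (n0 : N) (a b c d : E).

Definition res2_obj (n : nat) : lmodType E :=
  match n with
  | 0 => E^o
  | 1 => (E^o * E^o)%type
  | 2 => E^o
  | _ => 'rV[E]_0
  end.

Definition res2_diff1_fun (u : E^o * E^o) : E^o := u.1 * a + u.2 * b.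
Definition res2_diff2_fun (u : E^o) : E^o * E^o := (u * c, u * d).
Definition res2_aug_fun (u : E^o) : N := (u : E) *: n0.

Fact res2_diff1_is_linear : linear res2_diff1_fun.
Proof.
move=> e u v; rewrite /res2_diff1_fun /= !mulrDl addrACA.
by congr (_ + _); rewrite scalerDr; congr (_ + _); rewrite -mulrA.
Qed.
HB.instance Definition _ := GRing.isLinear.Build E (E^o * E^o)%type E^o _
  res2_diff1_fun res2_diff1_is_linear.

Fact res2_diff2_is_linear : linear res2_diff2_fun.
Proof.
by move=> e u v; congr (_, _); rewrite mulrDl; congr (_ + _); rewrite -mulrA.
Qed.
HB.instance Definition _ := GRing.isLinear.Build E E^o (E^o * E^o)%type _
  res2_diff2_fun res2_diff2_is_linear.

Fact res2_aug_is_linear : linear res2_aug_fun.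
Proof. by move=> e u v; rewrite /res2_aug_fun scalerDl scalerA. Qed.
HB.instance Definition _ := GRing.isLinear.Build E E^o N _
  res2_aug_fun res2_aug_is_linear.

Definition res2_diff (n : nat) : {linear res2_obj n.+1 -> res2_obj n} :=
  match n with
  | 0 => res2_diff1_fun
  | 1 => res2_diff2_fun
  | _ => \0
  end.

Hypothesis aug_surj : forall y : N, exists e : E, e *: n0 = y.
Hypothesis exact0 : forall e : E,
  e *: n0 = 0 <-> exists u v : E, u * a + v * b = e.
Hypothesis exact1 : forall u v : E,
  u * a + v * b = 0 <-> exists w : E, w * c = u /\ w * d = v.
Hypothesis exact2 : forall w : E, w * c = 0 -> w * d = 0 -> w = 0.

Lemma res2_projective n : projective (res2_obj n).
Proof.
case: n => [|[|[|n]]] /=; [|apply: projective_prod| |exact: projective_rV0];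
  exact: projective_regular.
Qed.

Lemma res2_exact0 (e : E^o) :
  res2_aug_fun e = 0 <-> exists u, res2_diff 0%N u = e.
Proof.
split=> [/exact0[u [v <-]]|[[u v] <-]]; first by exists (u, v).
by apply/exact0; exists u, v.
Qed.

Lemma res2_exactS n (e : res2_obj n.+1) :
  res2_diff n e = 0 <-> exists u, res2_diff n.+1 u = e.
Proof.
case: n e => [|[|n]] e.
- case: e => u v; apply: (iff_trans (exact1 u v)).
  by split=> -[w]; [case=> <- <- | case=> <- <-]; exists w.
- split=> [[uc ud]|[u <-]]; last by rewrite !linear0.
  by exists 0; rewrite (exact2 uc ud).
- by split=> // _; exists 0; rewrite [RHS]thinmx0.
Qed.

Definition length2_resolution : projResolution N :=
  @ProjResolution E N res2_obj res2_diff res2_aug_fun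
    res2_projective aug_surj res2_exact0 res2_exactS.

Section Tor.
Context (k : fieldType) (M : rmodType k E).

Fact ract_balanced : balanced (M := M) (N := E^o) (fun m e => ract m e).
Proof.
split=> [e r m m'|m e e'|m e e'] /=; first exact: ract_linear.
  exact: (ractDr m e e').
exact: esym (ractA _ _ _).
Qed.

Fact ract2_balanced : balanced (M := M) (N := (E^o * E^o)%type)
  (fun m e => (ract m e.1, ract m e.2) : (M * M)%type).
Proof.
split=> [e r m m'|m e e'|m e e'] /=; first by congr (_, _); exact: ract_linear.
  by congr (_, _); exact: (@ractDr _ _ M m).
by congr (_, _); exact: esym (ractA _ _ _).
Qed.

(** The isomorphism M (x) E = M, and next its analogue for E^2. They identify
    M (x) K, for K the resolution above, with M -> M^2 -> M, where a, b, c and d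
    act on M from the right. *)
Definition tens1_eval : {linear tensor M E^o -> M} := tlift ract_balanced.
Definition tens2_eval : {linear tensor M (E^o * E^o)%type -> (M * M)%type} :=
  tlift ract2_balanced.

Lemma tens1_evalE m (e : E^o) : tens1_eval (tens m e) = ract m e.
Proof. exact: tlift_tens. Qed.
Lemma tens2_evalE m (e : E^o * E^o) :
  tens2_eval (tens m e) = (ract m e.1, ract m e.2).
Proof. exact: tlift_tens. Qed.

Lemma tens1_evalK z : tens (tens1_eval z) (1 : E^o) = z.
Proof.
elim/tens_ind: z => [|m e z IH]; first by rewrite linear0 tens_zerol.
rewrite linearD tens_addl IH tens1_evalE tens_ract; congr (tens _ _ + _).
exact: mulr1.
Qed.

Lemma tens1_eval1 m : tens1_eval (tens m (1 : E^o)) = m.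
Proof. by rewrite tens1_evalE ract1. Qed.

Definition tens2_mk (m m' : M) : tensor M (E^o * E^o)%type :=
  tens m ((1, 0) : E^o * E^o) + tens m' ((0, 1) : E^o * E^o).

Lemma tens2_eval_mk m m' : tens2_eval (tens2_mk m m') = (m, m').
Proof.
rewrite linearD !tens2_evalE /= !ract1 !ract0r.
by congr (_, _); [exact: addr0 | exact: add0r].
Qed.

Lemma tens2_evalK z : tens2_mk (tens2_eval z).1 (tens2_eval z).2 = z.
Proof.
rewrite /tens2_mk; elim/tens_ind: z => [|m [e e'] z IH].
  by rewrite !linear0 !tens_zerol addr0.
rewrite linearD tens2_evalE /= !tens_addl addrACA [X in _ + X]IH !tens_ract.
rewrite -tens_addr; congr (tens _ _ + _).
by congr (_, _); rewrite /= scaler0 ?addr0 ?add0r; exact: mulr1.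
Qed.

Lemma tens1_eval_diff1 z :
  tens1_eval (tmap M (res2_diff 0%N) z) =
  ract (tens2_eval z).1 a + ract (tens2_eval z).2 b.
Proof.
elim/tens_ind: z => [|m [e e'] z IH].
  by rewrite !linear0 /= !ract0l addr0.
rewrite !linearD tmap_tens tens1_evalE tens2_evalE IH /= !ractDl addrACA.
by rewrite -!ractA -ractDr.
Qed.

Lemma tens2_eval_diff2 z :
  tens2_eval (tmap M (res2_diff 1%N) z) =
  (ract (tens1_eval z) c, ract (tens1_eval z) d).
Proof.
elim/tens_ind: z => [|m e z IH]; first by rewrite !linear0 /= !ract0l.
rewrite !linearD tmap_tens tens1_evalE tens2_evalE IH /= !ractDl.
by rewrite -!ractA.
Qed.

Local Notation K := length2_resolution.

(** This lemma and the next three compute Tor degree by degree from the complex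
    M -> M^2 -> M. *)
Lemma Tor_length2_0 (P : projResolution N) (T : lmodType k)
    (p : {linear rmod_sort M -> T}) :
  (forall s, exists m, p m = s) ->
  (forall m, p m = 0 <-> exists u v : M, ract u a + ract v b = m) ->
  lmod_iso (Tor M P 0%N) T.
Proof.
move=> p_surj p_ker.
pose p' : {linear tensor M (K 0%N) -> T} := p \o tens1_eval.
have p'E v : p' v = p (tens1_eval v) by [].
apply: (@Tor_iso _ _ _ _ _ K 0%N _ p') => [s|z _].
  have [m pm] := p_surj s; exists (tens m (1 : E^o)) => //.
  by rewrite p'E tens1_eval1.
rewrite p'E p_ker; split=> [[u [v uv]]|[z' <-]].
  exists (tens2_mk u v); rewrite -[RHS]tens1_evalK -uv -[LHS]tens1_evalK.
  by rewrite tor_diffS tens1_eval_diff1 tens2_eval_mk.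
exists (tens2_eval z').1, (tens2_eval z').2.
by rewrite tor_diffS tens1_eval_diff1.
Qed.

Lemma Tor_length2_1 (P : projResolution N) (T : lmodType k)
    (p : {linear (M * M)%type -> T}) :
  (forall s, exists u v : M, ract u a + ract v b = 0 /\ p (u, v) = s) ->
  (forall u v : M, ract u a + ract v b = 0 ->
     p (u, v) = 0 <-> exists m : M, ract m c = u /\ ract m d = v) ->
  lmod_iso (Tor M P 1%N) T.
Proof.
move=> p_surj p_ker.
pose p' : {linear tensor M (K 1%N) -> T} := p \o tens2_eval.
have p'E v : p' v = p (tens2_eval v) by [].
apply: (@Tor_iso _ _ _ _ _ K 1%N _ p') => [s|z dz].
  have [u [v [uv puv]]] := p_surj s; exists (tens2_mk u v).
    rewrite -[LHS]tens1_evalK tor_diffS tens1_eval_diff1 tens2_eval_mk uv.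
    exact: tens_zerol.
  by rewrite p'E tens2_eval_mk.
have := congr1 tens1_eval dz.
rewrite linear0 tor_diffS tens1_eval_diff1 => uv.
have := p_ker _ _ uv; rewrite -surjective_pairing p'E => ->.
split=> [[m [mc md]]|[z' <-]].
  exists (tens m (1 : E^o)).
  rewrite -[RHS]tens2_evalK -mc -md -[LHS]tens2_evalK.
  by rewrite tor_diffS tens2_eval_diff2 tens1_eval1.
by exists (tens1_eval z'); rewrite tor_diffS tens2_eval_diff2.
Qed.

Lemma Tor_length2_2 (P : projResolution N) (T : lmodType k) :
  (forall m : M, ract m c = 0 -> ract m d = 0 -> m = 0) ->
  (forall s : T, s = 0) -> lmod_iso (Tor M P 2%N) T.
Proof.
move=> inj T0.
pose p : {linear tensor M (K 2%N) -> T} := \0.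
apply: (@Tor_iso _ _ _ _ _ K 2%N _ p) => [s|z dz].
  by exists 0; rewrite ?linear0 // [RHS]T0.
have := congr1 tens2_eval dz; rewrite linear0 tor_diffS tens2_eval_diff2 => zcd.
have z0 : tens1_eval z = 0 := inj _ (congr1 fst zcd) (congr1 snd zcd).
by split=> // _; exists 0; rewrite linear0 -[RHS]tens1_evalK z0 tens_zerol.
Qed.

Lemma Tor_length2_gt2 (P : projResolution N) (T : lmodType k) n :
  (forall s : T, s = 0) -> lmod_iso (Tor M P n.+3) T.
Proof.
move=> T0.
pose p : {linear tensor M (K n.+3) -> T} := \0.
apply: (@Tor_iso _ _ _ _ _ K n.+3 _ p) => [s|z _].
  by exists 0; rewrite ?linear0 // [RHS]T0.
split=> // _; exists 0; rewrite linear0.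
elim/tens_ind: z => // m v z <-; rewrite addr0 [v]thinmx0.
by apply: (addrI (tens m 0)); rewrite -tens_addr !addr0.
Qed.
End Tor.
End LengthTwo.

(** * The enveloping algebra as an algebra over k *)
Section EnvelopingLinear.
Context (k : fieldType) (A : algType k).
Implicit Types (a b : A) (e : enveloping A).

Lemma env_tensDl b : {morph (@env_tens k A)^~ b : a a' / a + a'}.
Proof. by move=> a a'; exact: ptensDl. Qed.
Lemma env_tensDr a : {morph @env_tens k A a : b b' / b + b'}.
Proof. by move=> b b'; exact: ptensDr. Qed.
Lemma env_tensZl c a b : env_tens (c *: a) b = c *: (env_tens a b : talg A A^c).
Proof. exact: ptensZl. Qed.
Lemma env_tensZr c a b : env_tens a (c *: b) = c *: (env_tens a b : talg A A^c).
Proof. exact: ptensZr. Qed.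

Lemma env_scalerAl c (e e' : talg A A^c) : c *: (e * e') = (c *: e) * e'.
Proof.
elim/ptens_ind: e => [|a b e IH]; first by rewrite mul0r scaler0 mul0r.
rewrite mulrDl !scalerDr mulrDl -IH; congr (_ + _).
elim/ptens_ind: e' {IH} => [|a' b' e' IH']; first by rewrite !mulr0 scaler0.
by rewrite !mulrDr scalerDr IH' ptensM -!ptensZl ptensM scalerAl.
Qed.

Lemma env_scalerAr c (e e' : talg A A^c) : c *: (e * e') = e * (c *: e').
Proof.
elim/ptens_ind: e => [|a b e IH]; first by rewrite !mul0r scaler0.
rewrite !mulrDl !scalerDr -IH; congr (_ + _).
elim/ptens_ind: e' {IH} => [|a' b' e' IH'].
  by rewrite scaler0 !mulr0 scaler0.
by rewrite mulrDr !scalerDr mulrDr IH' ptensM -!ptensZl ptensM scalerAr.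
Qed.
End EnvelopingLinear.

Section AugmentedEnveloping.
Context (k : fieldType) (A : algType k) (eps : {linear A -> k^o}).
Hypothesis eps1 : eps 1 = 1.

Fact eps_balanced : balanced (M := vs_rmod A) (N := A^c)
  (fun a (b : A) => eps a * eps b : k^o).
Proof.
split=> [b c u v|a u v|a c b] /=.
- by rewrite linearP mulrDl -scalerAl.
- by rewrite (linearD eps) mulrDr.
- by rewrite !(linearZZ eps) -scalerAl -scalerAr.
Qed.

(** The same ring as [enveloping A]. A functional eps with eps 1 = 1 shows that
    it is not trivial, so that it carries the structure of a k-algebra. *)
Definition env_alg of eps 1 = 1 : Type := talg A A^c.
Local Notation E := (env_alg eps1).
HB.instance Definition _ := GRing.PzRing.on E.
HB.instance Definition _ := GRing.Lmodule.on E.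

Fact env_alg_oner_neq0 : (1 : E) != 0.
Proof.
apply/eqP => /(congr1 (tlift eps_balanced)); rewrite linear0.
move=> e; have := etrans (esym (tlift_tens eps_balanced 1 1)) e.
by rewrite eps1 mulr1 => /eqP; rewrite oner_eq0.
Qed.

HB.instance Definition _ :=
  GRing.PzSemiRing_isNonZero.Build E env_alg_oner_neq0.
Fact env_alg_scalerAl (c : k) (u v : E) : c *: (u * v) = (c *: u) * v.
Proof. exact: env_scalerAl. Qed.
HB.instance Definition _ := GRing.Lmodule_isLalgebra.Build k E env_alg_scalerAl.
Fact env_alg_scalerAr (c : k) (u v : E) : c *: (u * v) = u * (c *: v).
Proof. exact: env_scalerAr. Qed.
HB.instance Definition _ := GRing.Lalgebra_isAlgebra.Build k E env_alg_scalerAr.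

Definition etens (a b : A) : E := env_tens a b.

Lemma etens_linl b : linear (etens^~ b).
Proof. by move=> c u v; rewrite /etens env_tensDl env_tensZl. Qed.
Lemma etens_linr a : linear (etens a).
Proof. by move=> c u v; rewrite /etens env_tensDr env_tensZr. Qed.
Lemma etensM a b a' b' : etens a b * etens a' b' = etens (a * a') (b' * b).
Proof. exact: env_tensM. Qed.
Lemma etens11 : etens 1 1 = 1.
Proof. by []. Qed.
Lemma etens_ind (P : E -> Prop) :
  P 0 -> (forall a b e, P e -> P (etens a b + e)) -> forall e, P e.
Proof. exact: env_ind. Qed.

Section Extension.
Context (D : {linear A -> E}).
Fact env_lext_balanced : balanced (M := vs_rmod A) (N := A^c)
  (fun a (w : A) => etens a 1 * D w).
Proof.
split=> [w c a a'|a w w'|a c w] /=.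
- by rewrite etens_linl mulrDl scalerAl.
- by rewrite linearD mulrDr.
- rewrite (linearZZ D) -scalerAr scalerAl; congr (_ * _).
  by rewrite /etens env_tensZl.
Qed.
(** The extension of D : A -> E to E = A (x) A that is linear for the left
    multiplication by A on the first factor. *)
Definition env_lext : {linear E -> E} := tlift env_lext_balanced.
Lemma env_lextE a w : env_lext (etens a w) = etens a 1 * D w.
Proof. exact: tlift_tens. Qed.
End Extension.

Definition eaug : {linear E -> A} := tlift (env_lact_balanced (1 : A)).
Lemma eaugE a b : eaug (etens a b) = a * b.
Proof. by apply: etrans (tlift_tens _ _ _) _; rewrite mulr1. Qed.
End AugmentedEnveloping.

(** * The monomial basis of the quantum plane *)
Section MonomialBasis.
Context (k : fieldType) (q : k).

Definition qmon (i j : nat) : qplane q := qtens q 'X^i 'X^j.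

Lemma qmonM i j i' j' :
  qmon i j * qmon i' j' = q ^+ (i' * j) *: qmon (i + i') (j + j').
Proof.
rewrite /qmon -(qtens_mul q 'X^i) -(qtens_mul q 'X^i') mulrA.
rewrite -(mulrA (qtens q 'X^i 1)) qplane_yx -scalerAr -scalerAl.
rewrite -(qtens_mul q 'X^i') !mulrA qplane_xM -exprD; congr (_ *: _).
rewrite -mulrA [qtens q 1 _ * _](qmulXE q 1 j 1 'X^j') qtwist1 mulr1.
by rewrite -exprD qtens_mul.
Qed.

Lemma qplane_mon_ind (P : qplane q -> Prop) :
  (forall c u v, P u -> P v -> P (c *: u + v)) ->
  (forall i j, P (qmon i j)) -> forall u, P u.
Proof.
move=> PD Pm.
have P0 : P 0.
  by have := PD (-1) _ _ (Pm 0 0)%N (Pm 0 0)%N; rewrite scaleN1r addNr.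
elim/qplane_ind => // f j u Pu.
rewrite -[f]coefK poly_def; elim: (index_enum _) => [|i r IH].
  by rewrite big_nil qtens0l add0r.
by rewrite big_cons qtensDl qtensZl -addrA; apply: (PD) => //; exact: Pm.
Qed.

Section LinearExtension.
Context (W : lmodType k).

Definition poly_lin (v : nat -> W) (f : {poly k}) : W :=
  \sum_(i < size f) f`_i *: v i.

Lemma poly_lin_widen v n (f : {poly k}) : (size f <= n)%N ->
  poly_lin v f = \sum_(i < n) f`_i *: v i.
Proof.
move=> fn; rewrite /poly_lin (big_ord_widen _ (fun i : nat => f`_i *: v i) fn).
rewrite big_mkcond; apply: eq_bigr => i _ /=; case: ltnP => // fi.
by rewrite nth_default ?scale0r.
Qed.

Fact poly_lin_is_linear v : linear (poly_lin v).
Proof.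
move=> c f g; pose n := maxn (size f) (size g).
rewrite (@poly_lin_widen v n (c *: f + g)); last first.
  rewrite (leq_trans (size_polyD _ _)) // geq_max leq_maxr andbT.
  by rewrite (leq_trans (size_scale_leq _ _)) ?leq_maxl.
rewrite (@poly_lin_widen v n f) ?leq_maxl //.
rewrite (@poly_lin_widen v n g) ?leq_maxr //.
rewrite scaler_sumr -big_split /=; apply: eq_bigr => i _.
by rewrite coefD coefZ scalerDl scalerA.
Qed.
HB.instance Definition _ v := GRing.isLinear.Build k {poly k} W _ (poly_lin v)
  (poly_lin_is_linear v).

Lemma poly_linXn v i : poly_lin v 'X^i = v i.
Proof.
rewrite /poly_lin size_polyXn big_ord_recr /= big1 ?add0r => [|j _].
  by rewrite coefXn eqxx scale1r.
by rewrite coefXn ltn_eqF ?scale0r.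
Qed.

Fact mon_lin_balanced (v : nat -> nat -> W) :
  balanced (M := vs_rmod {poly k})
    (fun f g => poly_lin (fun i => poly_lin (v i) g) f).
Proof.
split=> [g|f g g'|f c g] /=; first exact: linearP.
- rewrite !(@poly_lin_widen _ (size f) f) // -big_split /=.
  by apply: eq_bigr => i _; rewrite linearD scalerDr.
- rewrite linearZZ !(@poly_lin_widen _ (size f) f) // scaler_sumr.
  apply: eq_bigr => i _.
  by rewrite [poly_lin _ (c *: g)]linearZZ !scalerA mulrC.
Qed.

(** The monomials are linearly independent in the strong sense that a linear map
    may be prescribed freely on them. *)
Definition mon_lin (v : nat -> nat -> W) : {linear qplane q -> W} :=
  tlift (mon_lin_balanced v).

Lemma mon_linE v i j : mon_lin v (qmon i j) = v i j.
Proof. by apply: etrans (tlift_tens _ _ _) _; rewrite !poly_linXn. Qed.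
End LinearExtension.
End MonomialBasis.

Lemma eq_poly_linear (k : fieldType) (W : lmodType k)
    (f g : {linear {poly k} -> W}) :
  (forall i, f 'X^i = g 'X^i) -> f =1 g.
Proof.
move=> fg p; rewrite -[p]coefK poly_def !linear_sum.
by apply: eq_bigr => i _; rewrite !(linearZZ f, linearZZ g) fg.
Qed.

(** * Algebras with a basis of q-commuting monomials *)
Section Commutators.
Context (k : fieldType) (A : algType k).

Definition ad (w u : A) : A := u * w - w * u.
Definition skew_r (c : k) (w u : A) : A := u * w - c *: (w * u).
Definition skew_l (c : k) (w u : A) : A := w * u - c *: (u * w).

Fact ad_is_linear w : linear (ad w).
Proof.
move=> c u v; rewrite /ad mulrDl mulrDr -scalerAl -scalerAr.
by rewrite scalerBr opprD addrACA.
Qed.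
HB.instance Definition _ w :=
  GRing.isLinear.Build k A A _ (ad w) (ad_is_linear w).

Fact skew_r_is_linear c w : linear (skew_r c w).
Proof.
move=> r u v; rewrite /skew_r mulrDl mulrDr -scalerAl -scalerAr scalerDr.
by rewrite scalerBr opprD addrACA !scalerA mulrC.
Qed.
HB.instance Definition _ c w :=
  GRing.isLinear.Build k A A _ (skew_r c w) (skew_r_is_linear c w).

Fact skew_l_is_linear c w : linear (skew_l c w).
Proof.
move=> r u v; rewrite /skew_l mulrDl mulrDr -scalerAl -scalerAr scalerDr.
by rewrite scalerBr opprD addrACA !scalerA mulrC.
Qed.
HB.instance Definition _ c w :=
  GRing.isLinear.Build k A A _ (skew_l c w) (skew_l_is_linear c w).
End Commutators.

(** The quantum plane enters only through its basis: mon i j stands for x^i y^j,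
    the monomials span ([mon_ind]), and linear maps are freely determined by
    their values on them ([lin]). *)
Section QuantumPlaneBasis.
Context (k : fieldType) (q : k) (A : algType k) (mon : nat -> nat -> A).
Hypothesis mon00 : mon 0 0 = 1.
Hypothesis monM : forall i j i' j',
  mon i j * mon i' j' = q ^+ (i' * j) *: mon (i + i') (j + j').
Hypothesis mon_ind : forall P : A -> Prop,
  (forall c u v, P u -> P v -> P (c *: u + v)) ->
  (forall i j, P (mon i j)) -> forall u, P u.
Context (lin : forall W : lmodType k, (nat -> nat -> W) -> {linear A -> W}).
Hypothesis linE : forall (W : lmodType k) (v : nat -> nat -> W) i j,
  lin v (mon i j) = v i j.
Local Notation x := (mon 1 0).
Local Notation y := (mon 0 1).

Lemma eq_mon_linear (W : lmodType k) (f g : {linear A -> W}) :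
  (forall i j, f (mon i j) = g (mon i j)) -> f =1 g.
Proof.
move=> fg; elim/mon_ind => // c u v fu fv.
by rewrite !linearP fu fv.
Qed.

Lemma x_mon i j : x * mon i j = mon i.+1 j.
Proof. by rewrite monM muln0 scale1r. Qed.

Lemma y_mon i j : y * mon i j = q ^+ i *: mon i j.+1.
Proof. by rewrite monM muln1. Qed.

Lemma mon_x i j : mon i j * x = q ^+ j *: mon i.+1 j.
Proof. by rewrite monM mul1n addn1 addn0. Qed.

Lemma mon_y i j : mon i j * y = mon i j.+1.
Proof. by rewrite monM mul0n scale1r addn1 addn0. Qed.

Lemma y_x : y * x = q *: (x * y).
Proof. by rewrite x_mon y_mon expr1. Qed.

Lemma xy_ind (P : A -> Prop) :
  (forall c u v, P u -> P v -> P (c *: u + v)) ->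
  (forall j, P (mon 0 j)) -> (forall u, P u -> P (x * u)) -> forall u, P u.
Proof.
move=> PD P0 PX; apply: mon_ind => // i j.
by elim: i => // i /PX; rewrite x_mon.
Qed.

(** ** Exactness of the Koszul complex *)

(** E is an algebra spanned by the tensors t a b, standing for a (x) b in the
    enveloping algebra, with the product of the second factors reversed;
    [ext] is the extension of maps from A that is A-linear on the left, and
    [aug] is the action of E on 1. *)
Section KoszulContraction.
Context (E : algType k) (t : A -> A -> E).
Hypothesis t_linl : forall b, linear (t^~ b).
Hypothesis t_linr : forall a, linear (t a).
Hypothesis tM : forall a b a' b', t a b * t a' b' = t (a * a') (b' * b).
Hypothesis t11 : t 1 1 = 1.
Hypothesis t_ind : forall P : E -> Prop,
  P 0 -> (forall a b e, P e -> P (t a b + e)) -> forall e, P e.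
Context (ext : {linear A -> E} -> {linear E -> E}).
Hypothesis extE : forall D a w, ext D (t a w) = t a 1 * D w.
Context (aug : {linear E -> A}).
Hypothesis augE : forall a b, aug (t a b) = a * b.

Lemma t0l b : t 0 b = 0.
Proof.
by have := t_linl b (-1) 0 0; rewrite /= scaler0 addr0 scaleN1r addNr.
Qed.

Lemma tZl c a b : t (c *: a) b = c *: t a b.
Proof. by have := t_linl b c a 0; rewrite /= addr0 t0l addr0. Qed.

Lemma tZr c a b : t a (c *: b) = c *: t a b.
Proof.
have t0 : t a 0 = 0.
  by have := t_linr a (-1) 0 0; rewrite /= scaler0 addr0 scaleN1r addNr.
by have := t_linr a c b 0; rewrite /= addr0 t0 addr0.
Qed.

Local Notation X1 := (t x 1).
Local Notation X2 := (t 1 x).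
Local Notation Y1 := (t y 1).
Local Notation Y2 := (t 1 y).

(** The partial derivative with respect to x, with weight p : each letter x of
    the word x^i y^j is replaced in turn by the tensor sign, with a factor p for
    each x to its left, so that the word goes to the sum over l < i of
    p^l x^l # x^(i-1-l) y^j. For p = 1 it is the x-part of the contraction in
    degree 0; for p = q it is the contraction in degree 1, as moving a y to the
    right past x^l costs the factor q^l. *)
Fixpoint xder_mon (p : k) (i j : nat) : E :=
  if i is i'.+1 then t 1 (mon i' j) + p *: (X1 * xder_mon p i' j) else 0.

Definition xder p : {linear A -> E} := lin (xder_mon p).

(** The partial derivative with respect to y: the word x^i y^j goes to the sum
    over l < j of x^i y^l # y^(j-1-l). *)
Fixpoint yder_mon (j : nat) : E :=
  if j is j'.+1 then t 1 (mon 0 j') + Y1 * yder_mon j' else 0.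

Definition yder : {linear A -> E} :=
  lin (fun i j => t (mon i 0) 1 * yder_mon j).

Lemma xder_x p w : xder p (x * w) = t 1 w + p *: (X1 * xder p w).
Proof.
elim/mon_ind: w => [c u v IHu IHv|i j].
  rewrite mulrDr -scalerAr !linearP IHu IHv t_linr mulrDr -scalerAr.
  by rewrite !scalerDr !scalerA (mulrC p c) addrACA.
by rewrite x_mon !linE.
Qed.

Lemma xder_mon0 p j : xder p (mon 0 j) = 0.
Proof. exact: linE. Qed.

Lemma yder_x w : yder (x * w) = X1 * yder w.
Proof.
elim/mon_ind: w => [c u v IHu IHv|i j].
  by rewrite mulrDr -scalerAr !linearP IHu IHv mulrDr -scalerAr.
by rewrite x_mon !linE mulrA tM x_mon mulr1.
Qed.

Lemma yder_mon00 : yder (mon 0 0) = 0.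
Proof. by rewrite linE mulr0. Qed.

Lemma yder_mon0S j : yder (mon 0 j.+1) = t 1 (mon 0 j) + Y1 * yder (mon 0 j).
Proof. by rewrite !linE mon00 t11 !mul1r. Qed.

(** The fundamental formula of the free differential calculus: the difference
    w#1 - 1#w telescopes along the letters of w. *)
Lemma der_contract w :
  xder 1 w * (X1 - X2) + yder w * (Y1 - Y2) = t w 1 - t 1 w.
Proof.
elim/xy_ind: w => [c u v IHu IHv|j|w IHw].
- rewrite !linearP !mulrDl addrACA IHv -!scalerAl -scalerDr IHu.
  by rewrite t_linl t_linr scalerBr opprD addrACA.
- rewrite xder_mon0 mul0r add0r; elim: j => [|j IHj].
    by rewrite yder_mon00 mul0r mon00 subrr.
  rewrite yder_mon0S mulrDl -mulrA IHj !mulrBr !tM !mulr1 !mul1r.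
  by rewrite !y_mon expr0 !scale1r addrC addrA subrK.
- rewrite xder_x scale1r yder_x mulrDl -addrA -!mulrA -mulrDr IHw.
  by rewrite !mulrBr !tM !mulr1 !mul1r addrC addrA subrK.
Qed.

Lemma yxM w : y * (x * w) = q *: (x * (y * w)).
Proof. by rewrite mulrA y_x -scalerAl mulrA. Qed.

Lemma Y1X1 : Y1 * X1 = q *: (X1 * Y1).
Proof. by rewrite !tM y_x tZl. Qed.

(** This lemma and the next are the two components of the homotopy identity in
    degree 1 on the generator dy; the correction terms come from reordering
    y w. *)
Lemma xder_contract w :
  xder q w * (Y1 - q *: Y2) = Y1 * xder 1 w - xder 1 (y * w).
Proof.
elim/xy_ind: w => [c u v IHu IHv|j|w IHw].
- rewrite [y * _]mulrDr -scalerAr !linearP mulrDl IHv -scalerAl IHu mulrDr.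
  by rewrite -scalerAr scalerBr addrACA /= scalerN.
- by rewrite y_mon expr0 scale1r !xder_mon0 mulr0 mul0r subrr.
- rewrite yxM (linearZZ (xder 1)) !xder_x !scale1r mulrDl -scalerAl -mulrA IHw.
  rewrite !mulrBr mulrDr [Y1 * (X1 * _)]mulrA Y1X1.
  rewrite -!scalerAl -!scalerAr -!mulrA.
  rewrite !tM !mulr1 !mul1r scalerBr scalerDr opprD.
  by rewrite addrACA.
Qed.

Lemma yder_contract w :
  xder q w * (X2 - q *: X1) = Y1 * yder w - yder (y * w) + t 1 w.
Proof.
elim/xy_ind: w => [c u v IHu IHv|j|w IHw].
- rewrite [y * _]mulrDr -scalerAr !linearP mulrDl IHv -scalerAl IHu.
  rewrite mulrDr t_linr -scalerAr scalerDr scalerBr addrACA.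
  by rewrite [X in X + _ = _]addrACA /= scalerN.
- rewrite y_mon expr0 scale1r xder_mon0 mul0r yder_mon0S [t 1 _ + _]addrC.
  by rewrite opprD addrA subrr sub0r addNr.
- rewrite yxM (linearZZ yder) !yder_x xder_x mulrDl -scalerAl -mulrA IHw.
  rewrite [X1 * (_ + _)]mulrDr !mulrBr [Y1 * (X1 * _)]mulrA Y1X1.
  rewrite -!scalerAl -!scalerAr -!mulrA.
  rewrite !tM !mulr1 !mul1r scalerDr scalerBr.
  by rewrite addrC -[LHS]addrA [X in _ + X = _]addrC subrK.
Qed.

(** The two differentials of the Koszul complex: the second encodes the
    noncommutative derivatives of the relation y x - q x y. *)
Definition koszul1 (u v : E) : E := u * (X1 - X2) + v * (Y1 - Y2).
Definition koszul2 (u : E) : E * E := (u * (Y1 - q *: Y2), u * (X2 - q *: X1)).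

Lemma aug_koszul1 u v : aug (koszul1 u v) = 0.
Proof.
have aug0 w e : aug (e * (t w 1 - t 1 w)) = 0.
  elim/t_ind: e => [|a b e IH]; first by rewrite mul0r linear0.
  rewrite mulrDl linearD IH addr0 mulrBr !tM linearB !augE.
  by rewrite !mul1r mulr1 mulrA subrr.
by rewrite linearD !aug0 addr0.
Qed.

Lemma koszul1_koszul2 u : koszul1 (koszul2 u).1 (koszul2 u).2 = 0.
Proof.
rewrite /koszul1 /= -!mulrA -mulrDr [X in _ * X](_ : _ = 0) ?mulr0 //.
rewrite !mulrBl !mulrBr -!scalerAl !tM !mulr1 !mul1r y_x tZl tZr.
apply/eqP; rewrite addr_eq0; apply/eqP.
by rewrite !opprD !opprK [RHS]addrC [RHS]addrACA.
Qed.

Lemma koszul_exact0 e : aug e = 0 -> exists u v, koszul1 u v = e.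
Proof.
(* Both sides are left A-linear in e, which reduces to [der_contract]. *)
have ex : koszul1 (ext (xder 1) e) (ext yder e) = t (aug e) 1 - e.
  elim/t_ind: e => [|a w e IH].
    by rewrite /koszul1 !linear0 !mul0r !addr0 t0l.
  rewrite /koszul1 !linearD !mulrDl addrACA [X in _ + X]IH !extE -!mulrA.
  rewrite -mulrDr der_contract mulrBr !tM !mulr1 augE.
  have := t_linl 1 1 (a * w) (aug e); rewrite /= !scale1r => ->.
  by rewrite addrACA.
move=> e0; exists (- ext (xder 1) e), (- ext yder e).
rewrite /koszul1 !mulNr -opprD [X in - X]ex e0.
by rewrite t0l sub0r opprK.
Qed.

(** The extension of D, taken after right multiplication by b#1 - 1#b, measures
    the failure of D to commute with left multiplication by b. For b = x this
    failure is given by [xder_x] and [yder_x], for b = y by [xder_contract] and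
    [yder_contract]. *)
Lemma ext_commutator D a w b :
  ext D (t a w * (t b 1 - t 1 b)) = t a 1 * (t b 1 * D w - D (b * w)).
Proof.
by rewrite mulrBr !tM mulr1 mul1r linearB !extE mulrBr mulrA tM mulr1.
Qed.

Lemma ext_xder_X u : ext (xder 1) (u * (X1 - X2)) = - u.
Proof.
elim/t_ind: u => [|a w u IH]; first by rewrite mul0r linear0 oppr0.
rewrite mulrDl linearD IH opprD ext_commutator xder_x scale1r; congr (_ - _).
by rewrite opprD addrCA subrr addr0 mulrN tM !mulr1.
Qed.

Lemma ext_yder_X u : ext yder (u * (X1 - X2)) = 0.
Proof.
elim/t_ind: u => [|a w u IH]; first by rewrite mul0r linear0.
by rewrite mulrDl linearD IH ext_commutator yder_x subrr mulr0 addr0.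
Qed.

Lemma ext_xder_Y v :
  ext (xder q) v * (Y1 - q *: Y2) = ext (xder 1) (v * (Y1 - Y2)).
Proof.
elim/t_ind: v => [|a w v IH]; first by rewrite !(mul0r, linear0).
rewrite [(_ + v) * _]mulrDl !linearD mulrDl IH ext_commutator extE -mulrA.
by rewrite xder_contract.
Qed.

Lemma ext_yder_Y v :
  ext (xder q) v * (X2 - q *: X1) = ext yder (v * (Y1 - Y2)) + v.
Proof.
elim/t_ind: v => [|a w v IH]; first by rewrite !(mul0r, linear0) addr0.
rewrite [(_ + v) * _]mulrDl !linearD mulrDl IH ext_commutator extE -mulrA.
by rewrite yder_contract mulrDr tM !mulr1 addrACA.
Qed.

Lemma ext_koszul2 u : ext (xder q) (koszul2 u).2 = u.
Proof.
elim/t_ind: u => [|a w u IH]; first by rewrite /= mul0r linear0.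
rewrite /= mulrDl linearD IH; congr (_ + _).
rewrite mulrBr -scalerAr !tM mul1r mulr1 linearB (linearZZ (ext _)) !extE.
by rewrite xder_x mulrDr -scalerAr mulrA !tM !mulr1 addrK.
Qed.

(** A preimage of a cycle (u, v) is given by the q-weighted derivative of v
    alone: the homotopy vanishes on the generator dx. *)
Lemma koszul_exact1 u v :
  koszul1 u v = 0 -> exists w, koszul2 w = (u, v).
Proof.
move=> uv0; exists (ext (xder q) v); congr (_, _).
  have := congr1 (ext (xder 1)) uv0; rewrite linearD linear0 ext_xder_X.
  by rewrite ext_xder_Y => /eqP; rewrite addrC subr_eq0 => /eqP.
have := congr1 (ext yder) uv0; rewrite linearD linear0 ext_yder_X add0r.
by rewrite ext_yder_Y => ->; rewrite add0r.
Qed.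

Lemma koszul_exact2 u : koszul2 u = (0, 0) -> u = 0.
Proof. by move=> u0; rewrite -(ext_koszul2 u) u0 linear0. Qed.
End KoszulContraction.

(** ** The homology of the commutator complex *)
Section SmallComplex.
Hypothesis q_not_root : forall m : nat, (0 < m)%N -> ~~ m.-unity_root q.

Lemma subr1_expq_neq0 i : 1 - q ^+ i.+1 != 0.
Proof.
have := q_not_root (ltn0Sn i); rewrite unity_rootE; apply: contra.
by rewrite subr_eq0 eq_sym.
Qed.

Local Notation ad_x := (ad x).
Local Notation ad_y := (ad y).
Local Notation tw_y := (skew_r q y).
Local Notation tw_x := (skew_l q x).

Lemma ad_x_mon i j : ad_x (mon i j) = (q ^+ j - 1) *: mon i.+1 j.
Proof. by rewrite /ad mon_x x_mon scalerBl scale1r. Qed.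
Lemma ad_y_mon i j : ad_y (mon i j) = (1 - q ^+ i) *: mon i j.+1.
Proof. by rewrite /ad mon_y y_mon scalerBl scale1r. Qed.
Lemma tw_y_mon i j : tw_y (mon i j) = (1 - q ^+ i.+1) *: mon i j.+1.
Proof. by rewrite /skew_r mon_y y_mon scalerBl scale1r scalerA -exprS. Qed.
Lemma tw_x_mon i j : tw_x (mon i j) = (1 - q ^+ j.+1) *: mon i.+1 j.
Proof. by rewrite /skew_l mon_x x_mon scalerBl scale1r scalerA -exprS. Qed.

(** The map m |-> m y - q y m is injective, with image the span of the monomials
    divisible by y; this is its inverse, extended by 0 to the powers of x. *)
Definition tw_y_inv : {linear A -> A} := lin (fun i j =>
  if j is j'.+1 then (1 - q ^+ i.+1)^-1 *: mon i j' else 0).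
(** The map v |-> v y - y v kills the powers of y and sends the span of the
    other monomials onto the span of the mixed ones; this is the inverse,
    extended by 0 to the pure powers. *)
Definition ad_y_inv : {linear A -> A} := lin (fun i j =>
  if (i, j) is (i'.+1, j'.+1) then (1 - q ^+ i)^-1 *: mon i j' else 0).

Definition proj_x : {linear A -> {poly k}} := lin (fun i j =>
  (if j is 0%N then 'X^i else 0) : {poly k}).
Definition proj_y : {linear A -> {poly k}} := lin (fun i j =>
  (if i is 0%N then 'X^j else 0) : {poly k}).

Lemma XS_in_polymulX i : 'X^(i.+1) \in @polymulX_pred k.
Proof. by rewrite unfold_in /polymulX_pred exprS dvdp_mulr. Qed.

Definition proj_y0 : {linear A -> polymulX k} := lin (fun i j =>
  if (i, j) is (0%N, j'.+1)
  then PolyMulX (XS_in_polymulX j') else 0 : polymulX k).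

Definition incl_x : {linear {poly k} -> A} := poly_lin (fun i => mon i 0).
Definition incl_y : {linear {poly k} -> A} := poly_lin (mon 0).

Lemma incl_xX i : incl_x 'X^i = mon i 0.
Proof. exact: poly_linXn. Qed.
Lemma incl_yX i : incl_y 'X^i = mon 0 i.
Proof. exact: poly_linXn. Qed.

(** The identities from this one to [ad_y_invE] say that [tw_y_inv] and
    [ad_y_inv] form a contraction of the complex A -> A^2 -> A onto the span of
    the pure powers; each is checked on monomials. *)
Lemma tw_y_invK u : tw_y_inv (tw_y u) = u.
Proof.
apply: (@eq_mon_linear _ (tw_y_inv \o tw_y) idfun) => i j.
rewrite /= tw_y_mon (linearZZ tw_y_inv) linE scalerA.
by rewrite divff ?scale1r ?subr1_expq_neq0.
Qed.

Lemma tw_y_tw_y_inv u : tw_y (tw_y_inv u) + incl_x (proj_x u) = u.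
Proof.
apply: (@eq_mon_linear _ ((tw_y \o tw_y_inv) \+ (incl_x \o proj_x)) idfun).
move=> i [|j]; rewrite /= !linE.
  by rewrite linear0 add0r incl_xX.
rewrite linear0 addr0 (linearZZ tw_y) /= tw_y_mon scalerA mulVf ?scale1r //.
exact: subr1_expq_neq0.
Qed.

Lemma tw_x_tw_y_inv u : tw_x (tw_y_inv u) + ad_y_inv (ad_x u) = 0.
Proof.
apply: (@eq_mon_linear _ ((tw_x \o tw_y_inv) \+ (ad_y_inv \o ad_x)) \0).
move=> i [|j]; rewrite /= ad_x_mon (linearZZ ad_y_inv) !linE.
  by rewrite linear0 scaler0 addr0.
rewrite (linearZZ tw_x) /= tw_x_mon !scalerA -scalerDl -[q ^+ j.+1 - 1]opprB.
rewrite mulNr [X in _ - X]mulrC subrr.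
exact: scale0r.
Qed.

Lemma ad_y_inv_ad_y v : ad_y_inv (ad_y v) + incl_y (proj_y v) = v.
Proof.
apply: (@eq_mon_linear _ ((ad_y_inv \o ad_y) \+ (incl_y \o proj_y)) idfun).
move=> [|i] j; rewrite /= ad_y_mon (linearZZ ad_y_inv) !linE.
  by rewrite scaler0 add0r incl_yX.
by rewrite linear0 addr0 scalerA divff ?scale1r ?subr1_expq_neq0.
Qed.

Lemma ad_y_invE u :
  ad_y (ad_y_inv u) + (incl_x (proj_x u) + incl_y (val (proj_y0 u))) = u.
Proof.
apply: (@eq_mon_linear _ ((ad_y \o ad_y_inv) \+
  ((incl_x \o proj_x) \+ (incl_y \o val \o proj_y0))) idfun).
move=> [|i] [|j]; rewrite /= !linE /= ?linear0 ?add0r ?addr0.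
- by rewrite incl_xX.
- by rewrite incl_yX.
- by rewrite incl_xX.
rewrite (linearZZ ad_y) /= ad_y_mon scalerA mulVf ?scale1r //.
exact: subr1_expq_neq0.
Qed.

Lemma proj_x_ad_x u : proj_x (ad_x u) = 0.
Proof.
apply: (@eq_mon_linear _ (proj_x \o ad_x) \0) => i [|j] /=.
  by rewrite ad_x_mon expr0 subrr scale0r linear0.
by rewrite ad_x_mon (linearZZ proj_x) linE scaler0.
Qed.

Lemma proj_x_ad_y u : proj_x (ad_y u) = 0.
Proof.
apply: (@eq_mon_linear _ (proj_x \o ad_y) \0) => i j /=.
by rewrite ad_y_mon (linearZZ proj_x) linE scaler0.
Qed.

Lemma proj_y0_ad_x u : proj_y0 (ad_x u) = 0.
Proof.
apply: (@eq_mon_linear _ (proj_y0 \o ad_x) \0) => i j /=.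
by rewrite ad_x_mon (linearZZ proj_y0) linE scaler0.
Qed.

Lemma proj_y0_ad_y u : proj_y0 (ad_y u) = 0.
Proof.
apply: (@eq_mon_linear _ (proj_y0 \o ad_y) \0) => -[|i] j /=.
  by rewrite ad_y_mon expr0 subrr scale0r linear0.
by rewrite ad_y_mon (linearZZ proj_y0) linE scaler0.
Qed.

Lemma proj_x_tw_y u : proj_x (tw_y u) = 0.
Proof.
apply: (@eq_mon_linear _ (proj_x \o tw_y) \0) => i j /=.
by rewrite tw_y_mon (linearZZ proj_x) linE scaler0.
Qed.

Lemma proj_y_tw_x u : proj_y (tw_x u) = 0.
Proof.
apply: (@eq_mon_linear _ (proj_y \o tw_x) \0) => i j /=.
by rewrite tw_x_mon (linearZZ proj_y) linE scaler0.
Qed.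

Lemma ad_x_incl_x f : ad_x (incl_x f) = 0.
Proof.
apply: (@eq_poly_linear _ _ (ad_x \o incl_x) \0) => i /=.
by rewrite incl_xX ad_x_mon expr0 subrr scale0r.
Qed.

Lemma ad_y_incl_y f : ad_y (incl_y f) = 0.
Proof.
apply: (@eq_poly_linear _ _ (ad_y \o incl_y) \0) => i /=.
by rewrite incl_yX ad_y_mon expr0 subrr scale0r.
Qed.

Lemma proj_x_incl_x f : proj_x (incl_x f) = f.
Proof.
apply: (@eq_poly_linear _ _ (proj_x \o incl_x) idfun) => i /=.
by rewrite incl_xX linE.
Qed.

Lemma proj_y_incl_y f : proj_y (incl_y f) = f.
Proof.
apply: (@eq_poly_linear _ _ (proj_y \o incl_y) idfun) => i /=.
by rewrite incl_yX linE.
Qed.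

Lemma proj_y0_incl_x f : proj_y0 (incl_x f) = 0.
Proof.
apply: (@eq_poly_linear _ _ (proj_y0 \o incl_x) \0) => -[|i] /=;
by rewrite incl_xX linE.
Qed.

Lemma proj_x_incl_y (g : polymulX k) : proj_x (incl_y (val g)) = 0.
Proof.
have g0 : (val g)`_0 = 0.
  by have /dvdpP[h ->] : 'X %| val g := valP g; rewrite coefMX.
rewrite linear_sum big1 // => -[[|i] /= _] _; rewrite linearZZ linE ?scaler0 //.
by rewrite g0 scale0r.
Qed.

Lemma proj_incl_y (g : {poly k}) :
  val (proj_y0 (incl_y g)) + proj_x (incl_y g) = g.
Proof.
apply: (@eq_poly_linear _ _
  ((val \o proj_y0 \o incl_y) \+ (proj_x \o incl_y)) idfun) => -[|i] /=;
by rewrite incl_yX !linE ?addr0 ?add0r.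
Qed.

Lemma proj_y0_incl_y (g : polymulX k) : proj_y0 (incl_y (val g)) = g.
Proof.
by apply: val_inj; have := proj_incl_y (val g); rewrite proj_x_incl_y addr0.
Qed.

(** The classes in degree 0: the coefficients of the pure powers, the constant
    one being recorded in the first component only. *)
Definition class0 (u : A) : ({poly k} * polymulX k)%type :=
  (proj_x u, proj_y0 u).
Fact class0_is_linear : linear class0.
Proof. by move=> c u v; rewrite /class0 !linearP. Qed.
HB.instance Definition _ :=
  GRing.isLinear.Build k A ({poly k} * polymulX k)%type _
    class0 class0_is_linear.

(** The classes in degree 1: the coefficients of x^i dx and of y^j dy. *)
Definition class1 (u : A * A) : ({poly k} * {poly k})%type :=
  (proj_x u.1, proj_y u.2).
Fact class1_is_linear : linear class1.
Proof. by move=> c u v; rewrite /class1 /= !linearP. Qed.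
HB.instance Definition _ := GRing.isLinear.Build k (A * A)%type
  ({poly k} * {poly k})%type _ class1 class1_is_linear.

Lemma class0_surj s : exists u, class0 u = s.
Proof.
case: s => f g; exists (incl_x f + incl_y (val g)); rewrite /class0 !linearD.
rewrite proj_x_incl_x proj_x_incl_y proj_y0_incl_x proj_y0_incl_y.
by rewrite addr0 add0r.
Qed.

Lemma class0_ker u : class0 u = 0 <-> exists v w, ad_x v + ad_y w = u.
Proof.
split=> [[u0 u0']|[v [w <-]]].
  exists 0, (ad_y_inv u); rewrite linear0 add0r -[RHS](ad_y_invE u) u0 u0'.
  by rewrite !linear0 !addr0.
by rewrite /class0 (linearD proj_x) (linearD proj_y0) proj_x_ad_x proj_x_ad_y
  proj_y0_ad_x proj_y0_ad_y !addr0.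
Qed.

Lemma class1_surj s : exists u v, ad_x u + ad_y v = 0 /\ class1 (u, v) = s.
Proof.
case: s => f g; exists (incl_x f), (incl_y g).
by rewrite ad_x_incl_x ad_y_incl_y addr0 /class1 /= proj_x_incl_x proj_y_incl_y.
Qed.

Lemma class1_ker u v : ad_x u + ad_y v = 0 ->
  class1 (u, v) = 0 <-> exists m, tw_y m = u /\ tw_x m = v.
Proof.
move=> uv; split=> [[u0 v0]|[m [<- <-]]]; last first.
  by rewrite /class1 /= proj_x_tw_y proj_y_tw_x.
exists (tw_y_inv u); split.
  by rewrite -[RHS](tw_y_tw_y_inv u) u0 linear0 addr0.
have := tw_x_tw_y_inv u; rewrite (_ : ad_x u = - ad_y v); last first.
  by apply/eqP; rewrite -addr_eq0 uv.
rewrite linearN => /eqP; rewrite subr_eq0 => /eqP ->.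
by rewrite -[RHS]ad_y_inv_ad_y v0 linear0 addr0.
Qed.

Lemma tw_y_inj u : tw_y u = 0 -> u = 0.
Proof. by move=> u0; rewrite -(tw_y_invK u) u0 linear0. Qed.
End SmallComplex.

(** ** Hochschild homology *)
Section HochschildHomology.
(** The constant coefficient, a functional with value 1 at 1. *)
Let eps : {linear A -> k^o} :=
  lin (fun i j => ((i == 0%N) && (j == 0%N))%:R : k^o).
Let eps1 : eps 1 = 1.
Proof. by rewrite -mon00 linE. Qed.
Local Notation Ae := (enveloping A).

Let a : Ae := env_tens x 1 - env_tens 1 x.
Let b : Ae := env_tens y 1 - env_tens 1 y.
Let c : Ae := env_tens y 1 - env_tens 1 (q *: y).
Let d : Ae := env_tens 1 x - env_tens (q *: x) 1.

Let t := @etens _ _ _ eps1.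
Let tl : forall b, linear (t^~ b) := @etens_linl _ _ _ eps1.
Let tr : forall a, linear (t a) := @etens_linr _ _ _ eps1.
Let tM := @etensM _ _ _ eps1.
Let tI := @etens_ind _ _ _ eps1.
Let t1 := @etens11 _ _ _ eps1.
Let extP := @env_lextE _ _ _ eps1.
Let augP := @eaugE _ _ _ eps1.

Lemma koszul_cE : c = t y 1 - q *: t 1 y.
Proof. by rewrite -(tZr tr). Qed.
Lemma koszul_dE : d = t 1 x - q *: t x 1.
Proof. by rewrite -(tZl tl). Qed.

Lemma koszul_aug_surj (z : env_lmod A) :
  exists e : Ae, e *: (1 : env_lmod A) = z.
Proof.
exists (env_tens z 1); apply: etrans (env_lactE _ _ _) _.
by rewrite !mulr1.
Qed.

Lemma koszul0P (e : Ae) :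
  e *: (1 : env_lmod A) = 0 <-> exists u v : Ae, u * a + v * b = e.
Proof.
split=> [|[u [v <-]]].
  exact: (koszul_exact0 tl tr tM t1 tI extP augP).
exact: (aug_koszul1 tM tI augP).
Qed.

Lemma koszul1P (u v : Ae) :
  u * a + v * b = 0 <-> exists w : Ae, w * c = u /\ w * d = v.
Proof.
split=> [uv|[w [<- <-]]].
  have [w [wc wd]] := koszul_exact1 tl tr tM t1 tI extP uv.
  by exists w; rewrite koszul_cE koszul_dE.
have := koszul1_koszul2 tl tr tM w.
by rewrite /koszul1 /koszul2 /= -koszul_cE -koszul_dE.
Qed.

Lemma koszul2P (w : Ae) : w * c = 0 -> w * d = 0 -> w = 0.
Proof.
rewrite koszul_cE koszul_dE => wc wd.
by apply: (koszul_exact2 tr tM tI extP); congr (_, _).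
Qed.

Definition koszul_resolution : projResolution (env_lmod A) :=
  length2_resolution koszul_aug_surj koszul0P koszul1P koszul2P.

(** The right action m (a#b) = b m a turns the elements of E that define the
    Koszul differentials into commutators and q-commutators. *)
Lemma ract_a (m : env_rmod A) : ract m a = ad x m.
Proof.
by rewrite ractB; congr (_ - _); rewrite [LHS]env_ractE ?mul1r ?mulr1.
Qed.

Lemma ract_b (m : env_rmod A) : ract m b = ad y m.
Proof.
by rewrite ractB; congr (_ - _); rewrite [LHS]env_ractE ?mul1r ?mulr1.
Qed.

Lemma ract_c (m : env_rmod A) : ract m c = skew_r q y m.
Proof.
by rewrite ractB; congr (_ - _); rewrite [LHS]env_ractE ?mul1r ?mulr1 ?scalerAl.
Qed.

Lemma ract_d (m : env_rmod A) : ract m d = skew_l q x m.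
Proof.
by rewrite ractB; congr (_ - _); rewrite [LHS]env_ractE ?mul1r ?mulr1 ?scalerAr.
Qed.

Hypothesis q_not_root : forall m : nat, (0 < m)%N -> ~~ m.-unity_root q.

Lemma HH_basis (P : projResolution (env_lmod A)) n :
  lmod_iso (HH P n) (HH_qplane k n).
Proof.
have rV0 (s : 'rV[k]_0) : s = 0 by exact: thinmx0.
case: n => [|[|[|n]]]; rewrite /HH.
- pose p : {linear rmod_sort (env_rmod A) -> ({poly k} * polymulX k)%type} :=
    class0.
  apply: (@Tor_length2_0 _ _ _ _ _ _ _ koszul_aug_surj koszul0P koszul1P
    koszul2P k (env_rmod A) P _ p) => [|m]; first exact: class0_surj.
  rewrite (class0_ker q_not_root); split=> -[u [v <-]]; exists u, v.
    by rewrite ract_a ract_b.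
  by rewrite ract_a ract_b.
- pose p : {linear (env_rmod A * env_rmod A)%type ->
      ({poly k} * {poly k})%type} := class1.
  apply: (@Tor_length2_1 _ _ _ _ _ _ _ koszul_aug_surj koszul0P koszul1P
    koszul2P k (env_rmod A) P _ p) => [s|u v].
    have [u [v [uv puv]]] := class1_surj s.
    by exists u, v; rewrite ract_a ract_b.
  rewrite ract_a ract_b => /(class1_ker q_not_root) ->.
  by split=> -[m mP]; exists m; rewrite ?ract_c ?ract_d // -ract_c -ract_d.
- apply: (@Tor_length2_2 _ _ _ _ _ _ _ koszul_aug_surj koszul0P koszul1P
    koszul2P k (env_rmod A) P) => // m; rewrite ract_c => mc _.
  exact: (tw_y_inj q_not_root mc).
- exact: (@Tor_length2_gt2 _ _ _ _ _ _ _ koszul_aug_surj koszul0P koszul1P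
    koszul2P k (env_rmod A) P 'rV[k]_0 n rV0).
Qed.
End HochschildHomology.
End QuantumPlaneBasis.

Theorem mainTheorem4 (k : fieldType) (q : k)
    (char0 : [pchar k] =i pred0)
    (q_neq0 : q != 0)
    (q_not_root : forall m : nat, (0 < m)%N -> ~~ m.-unity_root q) :
  inhabited (projResolution (env_lmod (qplane q))) /\
  (forall (P : projResolution (env_lmod (qplane q))) (n : nat),
    lmod_iso (HH P n) (HH_qplane k n)).
Proof.
have mon00 : qmon q 0 0 = 1 by rewrite /qmon !expr0.
split.
  exact: (inhabits (koszul_resolution mon00 (@qmonM k q) (@qplane_mon_ind k q)
    (@mon_linE k q))).
move=> P n.
exact: (HH_basis mon00 (@qmonM k q) (@qplane_mon_ind k q) (@mon_linE k q)
  q_not_root).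
Qed.
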